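(* Let $M$ be a matroid of size $n$ and rank $r=n-\ell$. Then $$0\leq \mathrm{ehr}_M'(0)\leq nH_n-rH_r-\ell H_\ell.$$ Furthermore, $\mathrm{ehr}_M'(0)=0$ if and only if $M\cong \mathsf{U}_{r,r}\oplus\mathsf{U}_{0,\ell}$, and $\mathrm{ehr}_M'(0)=nH_n-rH_r-\ell H_\ell$ if and only if $M\cong\mathsf{U}_{r,n}$.
   Context: Matroids are on finite ground sets; the size of a matroid is the number of elements of its ground set, identified with $\{1,\dots,n\}$. For a subset $A$ of the ground set let $\mathsf{e}_A=\sum_{i\in A}\mathsf{e}_i\in\{0,1\}^n$. The matroid polytope is $\mathscr{P}_M=\mathrm{conv}\{\mathsf{e}_B : B\text{ is a basis of }M\}\subset\mathbb{R}^n$. The Ehrhart polynomial $\mathrm{ehr}_M\in\mathbb{Q}[t]$ is the unique polynomial with $\mathrm{ehr}_M(k)=|\mathbb{Z}^n\cap k\mathscr{P}_M|$ for every integer $k\geq 0$; $\mathrm{ehr}_M'(0)$ is its linear coefficient. $H_k=1+\frac12+\dots+\frac1k$ are the harmonic numbers, with $H_0=0$. $\mathsf{U}_{r,n}$ is the uniform matroid of rank $r$ on $n$ elements, so $\mathsf{U}_{r,r}$ consists of $r$ coloops and $\mathsf{U}_{0,\ell}$ of $\ell$ loops; $\oplus$ is the direct sum of matroids. *)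

(* Defs.v *)
From HB Require Import structures.
From mathcomp Require Import all_boot all_order all_algebra.
From mathcomp Require Import boolp classical_sets cardinality reals convex.

Set Implicit Arguments.
Unset Strict Implicit.
Unset Printing Implicit Defensive.

Import Order.TTheory GRing.Theory Num.Theory.
Local Open Scope ring_scope.

(* Ground sets are arbitrary finite types, so that the disjoint union underlying
   a direct sum can be the sum type. *)
Record matroid (E : finType) := Matroid {
  bases : {set {set E}};
  bases_neq0 : bases != finset.set0;
  bases_exchange : forall A B : {set E}, A \in bases -> B \in bases ->
    forall x, x \in A :\: B ->
    exists2 y, y \in B :\: A & y |: (A :\ x) \in bases }.

Definition rank (E : finType) (M : matroid E) : nat :=
  \max_(B in bases M) #|B|.

Definition matroid_iso (E F : finType) (M : matroid E) (N : matroid F) : Prop :=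
  exists2 f : E -> F, bijective f &
    forall B : {set E}, (B \in bases M) = (f @: B \in bases N).

Section Uniform.
Variables (r n : nat) (hrn : (r <= n)%N).

Definition uniform_bases : {set {set 'I_n}} := [set B : {set 'I_n} | #|B| == r]%SET.

Lemma uniform_bases_neq0 : uniform_bases != finset.set0.
Proof.
rewrite -card_gt0 (eq_card (B := [pred B : {set 'I_n} | #|B| == r])); last first.
  by move=> B; rewrite !inE.
have := card_draws 'I_n r; rewrite card_ord cardsE => ->.
by rewrite bin_gt0.
Qed.

Lemma uniform_bases_exchange (A B : {set 'I_n}) :
  A \in uniform_bases -> B \in uniform_bases ->
  forall x, x \in A :\: B ->
  exists2 y, y \in B :\: A & y |: (A :\ x) \in uniform_bases.
Proof.
rewrite !inE => /eqP cA /eqP cB x xAB.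
have : (0 < #|B :\: A|)%N.
  have h : (0 < #|A :\: B|)%N by apply/card_gt0P; exists x.
  by move: h; rewrite !cardsD finset.setIC cA cB.
case/card_gt0P => y yBA; exists y => //.
move: xAB yBA; rewrite !inE => /andP[_ xA] /andP[yA _].
by rewrite cardsU1 !inE (negPf yA) andbF /= -cA (cardsD1 x A) xA.
Qed.

Definition uniform : matroid 'I_n :=
  Matroid uniform_bases_neq0 uniform_bases_exchange.

End Uniform.

Section DirectSum.
Variables (E F : finType) (M : matroid E) (N : matroid F).

Definition dsum_bases : {set {set E + F}} :=
  [set B : {set E + F} | (inl @^-1: B \in bases M) && (inr @^-1: B \in bases N)]%SET.

Lemma dsum_bases_neq0 : dsum_bases != finset.set0.
Proof.
have /finset.set0Pn[A AM] := bases_neq0 M.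
have /finset.set0Pn[B BN] := bases_neq0 N.
apply/finset.set0Pn.
exists [set z : E + F | match z with inl x => x \in A | inr y => y \in B end]%SET.
rewrite inE; apply/andP; split.
- by rewrite (_ : _ @^-1: _ = A) //; apply/finset.setP => x; rewrite !inE.
- by rewrite (_ : _ @^-1: _ = B) //; apply/finset.setP => x; rewrite !inE.
Qed.

Lemma dsum_bases_exchange (A B : {set E + F}) :
  A \in dsum_bases -> B \in dsum_bases ->
  forall x, x \in A :\: B ->
  exists2 y, y \in B :\: A & y |: (A :\ x) \in dsum_bases.
Proof.
rewrite !inE => /andP[AM AN] /andP[BM BN] [x|x] xAB.
- have xAB' : x \in (inl @^-1: A) :\: (inl @^-1: B) by move: xAB; rewrite !inE.
  have [y yBA yM] := bases_exchange AM BM xAB'.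
  exists (inl y); first by move: yBA; rewrite !inE.
  rewrite inE; apply/andP; split.
  + by rewrite (_ : _ @^-1: _ = y |: (inl @^-1: A) :\ x) //;
      apply/finset.setP => z; rewrite !inE.
  + by rewrite (_ : _ @^-1: _ = inr @^-1: A) //;
      apply/finset.setP => z; rewrite !inE.
- have xAB' : x \in (inr @^-1: A) :\: (inr @^-1: B) by move: xAB; rewrite !inE.
  have [y yBA yM] := bases_exchange AN BN xAB'.
  exists (inr y); first by move: yBA; rewrite !inE.
  rewrite inE; apply/andP; split.
  + by rewrite (_ : _ @^-1: _ = inl @^-1: A) //;
      apply/finset.setP => z; rewrite !inE.
  + by rewrite (_ : _ @^-1: _ = y |: (inr @^-1: A) :\ x) //;
      apply/finset.setP => z; rewrite !inE.
Qed.

Definition dsum : matroid (E + F)%type :=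
  Matroid dsum_bases_neq0 dsum_bases_exchange.

End DirectSum.

Local Open Scope classical_set_scope.

Section Ehrhart.
Variable R : realType.

Definition conv_hull (V : lmodType R) (A : set V) : set V :=
  smallest (@convex_set R V) A.

Variables (n : nat) (M : matroid 'I_n).

Definition indic (A : {set 'I_n}) : 'rV[R]_n := \sum_(i in A) delta_mx 0 i.

Definition matroid_polytope : set 'rV[R]_n :=
  conv_hull [set indic B | B in [set` bases M]].

Definition lattice_points (k : nat) : set 'rV[int]_n :=
  [set z | exists2 x, matroid_polytope x &
             map_mx (fun a : int => a%:~R : R) z = k%:R *: x].

Definition is_ehrhart (p : {poly rat}) : Prop :=
  forall k : nat, exists2 m : nat,
    (lattice_points k #= `I_m)%card & p.[k%:R] = m%:R.

Lemma is_ehrhart_unique (p q : {poly rat}) :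
  is_ehrhart p -> is_ehrhart q -> p = q.
Proof.
move=> hp hq; apply/eqP; rewrite -subr_eq0; apply: contraT => pq0.
pose s := [seq k%:R : rat | k <- iota 0 (size (p - q))].
suff : (size s < size (p - q)%R)%N by rewrite size_map size_iota ltnn.
apply: max_poly_roots => //; last first.
  by rewrite map_inj_uniq ?iota_uniq // => i j /eqP; rewrite eqr_nat => /eqP.
apply/allP => _ /mapP[k _ ->]; rewrite rootE hornerD hornerN.
have [m mk ->] := hp k; have [m' mk' ->] := hq k.
suff -> : m = m' by rewrite subrr.
by apply/card_eq_II; apply: card_eq_trans mk'; rewrite card_eq_sym.
Qed.

(* The integer points of k P are counted by p at every k >= 0; such a p is
   unique by is_ehrhart_unique, and the default 0 never qualifies because
   the polytope is nonempty. *)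
Definition ehr : {poly rat} := xget 0 [set p | is_ehrhart p].

End Ehrhart.

Definition harmonic_number (k : nat) : rat := \sum_(1 <= i < k.+1) i%:R^-1.

(* Main.v *)
Require Import Defs.
From mathcomp Require Import all_boot all_order all_algebra.
From mathcomp Require Import zify ring lra.
From mathcomp Require Import reals.

Set Implicit Arguments.
Unset Strict Implicit.
Unset Printing Implicit Defensive.

Import Order.TTheory GRing.Theory Num.Theory.
Local Open Scope ring_scope.

(** For an integer submodular function f on subsets of E = {1..n}, let P(f) be
the base polytope {x : x(S) <= f(S) for all S, x(E) = f(E)} and N(f) its number
of integer points.  P(f) is the convex hull of its integer points, and for the
rank function rk of M the polytope k P_M is P(k rk), so ehr_M(k) = N(k rk).

N is a polynomial function of f on the submodular functions, by induction on
the ground set.  Raising f(S) by one adds the face x(S) = f(S), a product of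
smaller base polytopes, and adding the cut function [i in S, j notin S] adds the
projection along e_i - e_j.  The first move is only legal deep inside the
submodular cone, the second is always legal and leads there from any f.

Hence the linear coefficient of k |-> N(k f) is additive in f.  It equals
H_(|A|-1) on f_A(S) = [S meets A], whose polytope is a simplex, and the f_A span
all functions vanishing at the empty set.  This identifies it with
  L(f) = sum_(0 < |S| < n) (|S|-1)! (n-|S|-1)! / (n-1)! f(S) - H_(n-1) f(E).
All weights are positive, and L(S |-> |B cap S|) = 0, so both bounds and their
equality cases follow from |B cap S| <= rk S <= min(|S|, r) for a basis B. *)

(** * Polynomial maps on abelian groups *)

(** Polynomiality of k |-> N(k f) for each f separately relates no two functions f. Additivity of
    the linear coefficient needs N(k f + l g) to be polynomial in k and l jointly, hence polynomial
    maps on the whole group of set functions. The polynomial also extends N beyond the submodular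
    cone, so signed combinations of the f_A cause no trouble. Rank functions typically lie on the
    boundary of the cone, where raising one value may leave it. The count is therefore computed
    twice at f + M c, with c strictly submodular: by face moves from M c, for large M only, and by
    cut moves from f, for every M >= 0. Both answers are polynomial in M, so they agree at M = 0 as
    well, where the second is N(f). *)

Section PolynomialMaps.
Implicit Types (U V : zmodType).

(** Degree less than [d], the zero map being the case [d = 0]. Using iterated differences avoids
    coordinates, so one notion serves set functions, integers and their products. *)
Fixpoint pdeg V (d : nat) (F : V -> rat) : Prop :=
  if d is d'.+1 then forall v, pdeg d' (fun x => F (x + v) - F x)
  else forall x, F x = 0.

Definition polyf V (F : V -> rat) : Prop := exists d, pdeg d F.

Lemma pdeg_ext V d (F G : V -> rat) : F =1 G -> pdeg d F -> pdeg d G.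
Proof.
elim: d F G => [|d IHd] F G eFG /= hF; first by move=> x; rewrite -eFG.
by move=> v; apply: IHd (hF v) => x /=; rewrite !eFG.
Qed.

Lemma pdeg0 V d : pdeg d (fun _ : V => 0).
Proof.
by elim: d => //= d IHd v; apply: pdeg_ext IHd => x; rewrite subrr.
Qed.

Lemma pdegS V d (F : V -> rat) : pdeg d F -> pdeg d.+1 F.
Proof.
elim: d F => [|d IHd] F /=; first by move=> F0 v x; rewrite !F0 subrr.
by move=> hF v; apply: IHd.
Qed.

Lemma pdeg_leq V d e (F : V -> rat) : (d <= e)%N -> pdeg d F -> pdeg e F.
Proof.
by move=> /subnKC <-; elim: (e - d)%N => [|k IH] /=;
  rewrite ?addn0 // addnS => /IH/pdegS.
Qed.

Lemma pdegD V d (F G : V -> rat) :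
  pdeg d F -> pdeg d G -> pdeg d (fun x => F x + G x).
Proof.
elim: d F G => [|d IHd] F G /= hF hG; first by move=> x; rewrite hF hG addr0.
by move=> v; apply: pdeg_ext (IHd _ _ (hF v) (hG v)) => x /=; ring.
Qed.

Lemma pdegZ V d c (F : V -> rat) : pdeg d F -> pdeg d (fun x => c * F x).
Proof.
elim: d F => [|d IHd] F /= hF; first by move=> x; rewrite hF mulr0.
by move=> v; apply: pdeg_ext (IHd _ (hF v)) => x /=; rewrite mulrBr.
Qed.

Lemma pdeg_comp U V d (F : V -> rat) (h : U -> V) (c : V) :
  {morph h : x y / x + y} -> pdeg d F -> pdeg d (fun x => F (h x + c)).
Proof.
move=> hD; elim: d F => [|d IHd] F /= hF; first by move=> x; rewrite hF.
move=> v; apply: pdeg_ext (IHd _ (hF (h v))) => x /=.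
by rewrite hD addrAC.
Qed.

Lemma pdeg_shift V d (F : V -> rat) (c : V) :
  pdeg d F -> pdeg d (fun x => F (x + c)).
Proof. exact: (@pdeg_comp _ _ _ _ id). Qed.

(** Discrete Leibniz rule: the difference of F G along v is (F(x+v) - F(x)) G(x+v) + F(x) (G(x+v) -
    G(x)), and induction on [d + e] applies to both terms. *)
Lemma pdegM V d e (F G : V -> rat) :
  pdeg d F -> pdeg e G -> pdeg (d + e) (fun x => F x * G x).
Proof.
move: {2}(d + e)%N (erefl (d + e)%N) => k.
elim: k d e F G => [|k IHk] [|d] [|e] F G //= ek hF hG;
  try by [apply: pdeg_ext (pdeg0 V _) => x; rewrite hF mul0r
         |apply: (pdeg_ext _ (pdeg0 V (d + 0).+1)) => x; rewrite hG mulr0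
         |move=> v; apply: pdeg_ext (pdeg0 V _) => x; rewrite ?hF ?hG; ring
         |move=> x; rewrite hF mul0r].
move=> v.
have hGv : pdeg e.+1 (fun x => G (x + v)) by exact: pdeg_shift.
have h1 := IHk d e.+1 _ _ _ (hF v) hGv.
have h2 := IHk d.+1 e _ _ _ hF (hG v).
have {}h1 : pdeg (d + e.+1) (fun x => (F (x + v) - F x) * G (x + v)) by apply: h1; lia.
have {}h2 : pdeg (d + e.+1) (fun x => F x * (G (x + v) - G x)).
  by rewrite addnS -addSn; apply: h2; lia.
by apply: pdeg_ext (pdegD h1 h2) => x /=; ring.
Qed.

Lemma pdeg_cst V (c : rat) : pdeg 1 (fun _ : V => c).
Proof. by move=> v x; rewrite subrr. Qed.

Lemma polyf_ext V (F G : V -> rat) : F =1 G -> polyf F -> polyf G.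
Proof. by move=> e [d hF]; exists d; apply: pdeg_ext hF. Qed.

Lemma polyf_cst V c : polyf (fun _ : V => c).
Proof. by exists 1%N; apply: pdeg_cst. Qed.

Lemma polyfD V (F G : V -> rat) :
  polyf F -> polyf G -> polyf (fun x => F x + G x).
Proof.
move=> [d hF] [e hG]; exists (maxn d e).
by apply: pdegD; [apply: pdeg_leq hF | apply: pdeg_leq hG]; lia.
Qed.

Lemma polyfM V (F G : V -> rat) :
  polyf F -> polyf G -> polyf (fun x => F x * G x).
Proof. by move=> [d hF] [e hG]; exists (d + e)%N; apply: pdegM. Qed.

Lemma polyfB V (F G : V -> rat) :
  polyf F -> polyf G -> polyf (fun x => F x - G x).
Proof.
move=> hF hG; apply: (@polyf_ext _ (fun x => F x + -1 * G x)).
  by move=> x; ring.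
by apply: polyfD hF _; apply: polyfM hG; apply: polyf_cst.
Qed.

Lemma polyf_comp U V (F : V -> rat) (h : U -> V) (c : V) :
  {morph h : x y / x + y} -> polyf F -> polyf (fun x => F (h x + c)).
Proof. by move=> hD [d hF]; exists d; apply: pdeg_comp. Qed.

(** The difference along 1 vanishes on the same half-line, hence everywhere by induction on the
    degree; so [F] is constant. This carries identities known for large M down to M = 0. *)
Lemma polyf_eq0 (F : int -> rat) (m0 : int) :
  polyf F -> (forall m, m0 <= m -> F m = 0) -> forall m, F m = 0.
Proof.
case=> d; elim: d F => [|d IHd] F //= hF F0.
have dF (m : int) : F (m + 1) - F m = 0.
  apply: IHd (hF 1) _ m => m lem; rewrite !F0 ?subrr //.
  by apply: le_trans lem _; rewrite lerDl.
have Fk (k : nat) (m : int) : F (m + k%:Z) = F m.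
  elim: k => [|k IHk]; first by rewrite addr0.
  have := dF (m + k%:Z); rewrite (_ : m + k%:Z + 1 = m + k.+1); last by lia.
  by move/eqP; rewrite subr_eq0 => /eqP ->.
move=> m; rewrite -(Fk `|m0 - m|%N m); apply: F0; lia.
Qed.

(** The oriented sum from 0 to [m]. The sign on the negative branch makes [sumzS] hold on all
    integers; values of set functions, the upper limits in use, may be negative. *)
Definition sumz (F : int -> rat) (m : int) : rat :=
  match m with
  | Posz n => \sum_(j < n) F j
  | Negz n => - \sum_(j < n.+1) F (- (j.+1)%:Z)
  end.

Lemma sumzS F m : sumz F (m + 1) = sumz F m + F m.
Proof.
case: m => [n|[|n]]; rewrite /sumz.
- by rewrite -PoszD addn1 big_ord_recr.
- rewrite (_ : Negz 0 + 1 = Posz 0) //= big_ord0 big_ord_recr big_ord0 /= add0r.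
  by rewrite NegzE addNr.
- rewrite (_ : Negz n.+1 + 1 = Negz n) /=; last by lia.
  by rewrite [in RHS]big_ord_recr /= opprD -addrA NegzE addNr addr0.
Qed.

Lemma eq_sumz F G m : F =1 G -> sumz F m = sumz G m.
Proof.
by move=> eFG; case: m => n; rewrite /sumz; [|congr (- _)];
  apply: eq_bigr => j _; rewrite eFG.
Qed.

Lemma sumz0 F : sumz F 0 = 0. Proof. exact: big_ord0. Qed.

(** The recurrence is required only between 0 and [m]: for point counts it is available only where
    the intermediate functions are submodular. *)
Lemma sumz_unique (F : int -> rat) (u : int -> rat) (m : int) :
  (forall j, (0 <= j < m) || (m <= j < 0) -> u (j + 1) = u j + F j) ->
  u m = u 0 + sumz F m.
Proof.
case: m => n.
- elim: n => [|n IHn] hu; first by rewrite sumz0 addr0.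
  rewrite -addn1 PoszD hu ?sumzS ?addrA; last by lia.
  congr (_ + _); apply: IHn => j hj; apply: hu; lia.
- elim: n => [|n IHn] hu.
    have := hu (- 1); have := sumzS F (-1); rewrite addNr sumz0.
    rewrite (_ : Negz 0 = -1) // => e -> //.
    by rewrite -addrA [X in u (-1) + X]addrC -e addr0.
  have e : Negz n = Negz n.+1 + 1 by lia.
  have h : u (Negz n) = u 0 + sumz F (Negz n).
    by apply: IHn => j hj; apply: hu; lia.
  apply: (addIr (F (Negz n.+1))); rewrite -addrA -sumzS -hu; last by lia.
  by rewrite -e.
Qed.

Lemma sumz_shift F m a : sumz F (m + a) = sumz F m + sumz (fun j => F (m + j)) a.
Proof.
rewrite (@sumz_unique (fun j => F (m + j)) (fun a => sumz F (m + a))) ?addr0 //.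
by move=> j _; rewrite addrA sumzS.
Qed.

Lemma pdeg_sum V I (r : seq I) d (F : I -> V -> rat) :
  (forall i, pdeg d (F i)) -> pdeg d (fun x => \sum_(i <- r) F i x).
Proof.
move=> hF; elim: r => [|i r IHr].
  by apply: pdeg_ext (pdeg0 V d) => x; rewrite big_nil.
by apply: pdeg_ext (pdegD (hF i) IHr) => x; rewrite big_cons.
Qed.

(** The difference along (a, w) splits into the sum of F(m+j, v+w) for j from 0 to a, a fixed
    combination of translates of F, and the same construction applied to the difference of F along
    (0, w), of lower degree. *)
Lemma pdeg_sumz V d (F : (int * V)%type -> rat) :
  pdeg d F -> pdeg d.+1 (fun x => sumz (fun j => F (j, x.2)) x.1).
Proof.
elim: d F => [|d IHd] F hF.
  apply: pdeg_ext (pdeg0 _ 1) => -[m v] /=.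
  case: m => n; rewrite /sumz big1 ?oppr0 // => j _; exact: hF.
move=> [a w].
have h1 : pdeg d.+1 (fun x : int * V => sumz (fun j => F (x + (j, w))) a).
  have hs c : pdeg d.+1 (fun x => F (x + c)) by exact: pdeg_shift.
  case: a => n; rewrite /sumz.
  - by apply: pdeg_sum => i.
  - apply: (@pdeg_ext _ _ (fun x => -1 * \sum_(j < n.+1) F (x + (- j.+1%:Z, w)))).
      by move=> x; rewrite mulN1r.
    by apply: pdegZ; apply: pdeg_sum => i; apply: hs.
have := IHd _ (hF (0, w)) => h2.
apply: pdeg_ext (pdegD h1 h2) => -[m v] /=.
rewrite sumz_shift.
set X := sumz _ a; set Y := sumz _ m; set Z := sumz _ m; set T := sumz _ m.
rewrite (_ : X = sumz (fun j => F (m + j, v + w)) a) //.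
have -> : Y = Z - T.
  set u := fun k => sumz (fun j => F (j, v + w)) k - sumz (fun j => F (j, v)) k.
  have u0 : u 0 = 0 by rewrite /u !sumz0 subrr.
  apply/esym; rewrite -[LHS]/(u m).
  rewrite (@sumz_unique (fun j => F ((j, v) + (0, w)) - F (j, v)) u m) ?u0 ?add0r //.
  move=> j _.
  rewrite /u !sumzS (_ : (j, v) + (0, w) = (j, v + w)); first by ring.
  by congr pair; rewrite /= addr0.
by ring.
Qed.

Lemma polyf_sumz V (F : (int * V)%type -> rat) :
  polyf F -> polyf (fun x => sumz (fun j => F (j, x.2)) x.1).
Proof. by move=> [d hF]; exists d.+1; apply: pdeg_sumz. Qed.

End PolynomialMaps.

(** * Newton expansion and the linear coefficient *)

Lemma poly_nat_inj (p q : {poly rat}) :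
  (forall k : nat, p.[k%:R] = q.[k%:R]) -> p = q.
Proof.
move=> epq; apply/eqP; rewrite -subr_eq0; apply: contraT => pq0.
pose s := [seq k%:R : rat | k <- iota 0 (size (p - q))].
suff : (size s < size (p - q)%R)%N by rewrite size_map size_iota ltnn.
apply: max_poly_roots => //.
  by apply/allP => _ /mapP[k _ ->]; rewrite rootE hornerD hornerN epq subrr.
by rewrite map_inj_uniq ?iota_uniq // => i j /eqP; rewrite eqr_nat => /eqP.
Qed.

Definition binp (i : nat) : {poly rat} :=
  (i`!%:R)^-1 *: \prod_(j < i) ('X - (j%:R)%:P).

Lemma horner_binp i k : (binp i).[k%:R] = 'C(k, i)%:R.
Proof.
have fact0 : i`!%:R != 0 :> rat by rewrite pnatr_eq0 -lt0n fact_gt0.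
apply: (mulfI fact0); rewrite hornerZ mulrA divff // mul1r -natrM mulnC bin_ffact.
elim: i {fact0} => [|i IHi]; first by rewrite big_ord0 hornerE ffactn0.
rewrite big_ord_recr /= hornerM IHi !hornerE ffactnSr natrM.
have [leik|ltki] := leqP i k; first by rewrite natrB.
by rewrite ffact_small // !mul0r.
Qed.

Lemma binp0 : binp 0 = 1.
Proof. by rewrite /binp big_ord0 fact0 invr1 scale1r. Qed.

Lemma coef0_binpS i : (binp i.+1)`_0 = 0.
Proof. by rewrite -horner_coef0 (horner_binp i.+1 0). Qed.

Section Newton.
Variable V : zmodType.
Implicit Types (F : V -> rat) (v w x : V).

Definition dif v F : V -> rat := fun x => F (x + v) - F x.

Lemma pdeg_dif d v F : pdeg d F -> pdeg d (dif v F).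
Proof. by move=> /pdegS; apply. Qed.

Lemma pdeg_iter_dif d v i F : pdeg d F -> pdeg d (iter i (dif v) F).
Proof. by move=> hF; elim: i => //= i; apply: pdeg_dif. Qed.

Lemma newton_expansion d F v x k : pdeg d F ->
  F (x + v *+ k) = \sum_(i < d) 'C(k, i)%:R * iter i (dif v) F x.
Proof.
elim: d F k => [|d IHd] F k hF; first by rewrite big_ord0 hF.
elim: k => [|k IHk].
  rewrite addr0 big_ord_recl big1 ?addr0 /= ?bin0 ?mul1r // => i _.
  by rewrite bin0n mul0r.
rewrite mulrSr addrA.
have -> : F (x + v *+ k + v) = F (x + v *+ k) + dif v F (x + v *+ k).
  by rewrite /dif [RHS]addrC subrK.
rewrite (IHd (dif v F)); last exact: hF.
rewrite IHk !big_ord_recl !bin0 -addrA; congr (_ + _).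
rewrite -big_split; apply: eq_bigr => i _ /=.
by rewrite -iterSr /= binS natrD mulrDl.
Qed.

Definition newton_poly d v F : {poly rat} :=
  \sum_(i < d) iter i (dif v) F 0 *: binp i.

Lemma newton_polyE d v F (k : nat) : pdeg d F ->
  (newton_poly d v F).[k%:R] = F (v *+ k).
Proof.
move=> hF; rewrite -[v *+ k]add0r (newton_expansion _ _ _ hF) horner_sum.
by apply: eq_bigr => i _; rewrite hornerZ horner_binp mulrC.
Qed.

(** Defined at every [v]: applied to the polynomial extending the point count, it makes sense for
    functions that are not submodular. *)
Definition linear_coef d F v : rat := (newton_poly d v F)`_1.

(* Expanding first along v and then along w, the linear coefficient of
   k |-> F (k (v + w)) only sees the terms where one of the two binomials
   is constant. *)
Lemma linear_coefD d F v w : pdeg d F ->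
  linear_coef d F (v + w) = linear_coef d F v + linear_coef d F w.
Proof.
move=> hF; pose G i := newton_poly d w (iter i (dif v) F).
have eG : newton_poly d (v + w) F = \sum_(i < d) binp i * G i.
  apply: poly_nat_inj => k.
  rewrite newton_polyE // mulrnDl addrC (newton_expansion _ _ _ hF) horner_sum.
  apply: eq_bigr => i _; rewrite hornerM horner_binp newton_polyE //.
  exact: pdeg_iter_dif.
rewrite /linear_coef eG coef_sum [X in _ = X + _]coef_sum.
case: d hF @G {eG} => [|d] hF G; first by rewrite /newton_poly !big_ord0 coef0 addr0.
rewrite [LHS]big_ord_recl [X in _ = X + _]big_ord_recl /= binp0 mul1r.
rewrite coefZ coef1 mulr0 add0r addrC; congr (_ + _).
apply: eq_bigr => i _; rewrite coefM big_ord_recl big_ord1 coef0_binpS mul0r add0r.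
rewrite -horner_coef0 -[0]/(0%:R) newton_polyE ?mulr0n; last exact: (pdeg_iter_dif v i.+1).
by rewrite [RHS]coefZ [RHS]mulrC; congr (_ * _).
Qed.

End Newton.

(** * The rank function of a matroid *)

Section MatroidRank.
Variables (E : finType) (M : matroid E).
Implicit Types (A B S T X Y : {set E}).
Local Open Scope nat_scope.

Definition rk S : nat := \max_(B in bases M) #|B :&: S|.

Lemma rk_ge S B : B \in bases M -> #|B :&: S| <= rk S.
Proof. by move=> BM; apply: (leq_bigmax_cond (F := fun B => #|B :&: S|)). Qed.

Lemma ex_basis : exists B, B \in bases M.
Proof. exact/set0Pn/bases_neq0. Qed.

Lemma rk_attained S : exists2 B, B \in bases M & #|B :&: S| = rk S.
Proof.
have [B0 B0M] := ex_basis.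
have h : 0 < #|bases M| by apply/card_gt0P; exists B0.
by have [B BM e] := eq_bigmax_cond (fun B => #|B :&: S|) h; exists B.
Qed.

(** The element removed lies outside [B] and the one added inside, so the overlap with [B] grows;
    extremal arguments below maximize this overlap. *)
Lemma bases_exchange_closer A B x : A \in bases M -> B \in bases M -> x \in A :\: B ->
  exists y, [/\ y \in B :\: A, y |: (A :\ x) \in bases M,
    #|y |: (A :\ x)| = #|A| & #|A :&: B| < #|(y |: (A :\ x)) :&: B|].
Proof.
move=> AM BM xAB; have [y yBA yM] := bases_exchange AM BM xAB.
exists y; move: xAB yBA; rewrite !inE => /andP[xB xA] /andP[yA yB]; split => //.
- by rewrite yA.
- by rewrite cardsU1 !inE (negPf yA) andbF /= [in RHS](cardsD1 x A) xA.
- rewrite (_ : (y |: A :\ x) :&: B = y |: (A :&: B)); last first.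
    apply/setP => z; rewrite !inE; case: (eqVneq z y) => [->|_] //=.
    by case: (eqVneq z x) => [->|_] //=; rewrite (negPf xB) andbF.
  by rewrite cardsU1 !inE (negPf yA).
Qed.

(** A basis of the size of [A] with maximal overlap with [B] must lie in [B], as any exchange would
    increase the overlap. *)
Lemma card_bases_leq A B : A \in bases M -> B \in bases M -> #|A| <= #|B|.
Proof.
move=> AM BM; rewrite leqNgt; apply/negP => ltBA.
have [A' /andP[A'M /eqP cA'] maxA'] := @arg_maxnP _ A
  (fun X => (X \in bases M) && (#|X| == #|A|)) (fun X => #|X :&: B|)
  (introT andP (conj AM (eqxx _))).
have : ~~ (A' \subset B).
  by apply/negP => /subset_leq_card; rewrite cA' leqNgt ltBA.
case/subsetPn => x xA' xB.
have [|y [_ yM cy]] := @bases_exchange_closer A' B x A'M BM; first by rewrite inE xB.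
apply/negP; rewrite -leqNgt; apply: maxA'; by rewrite yM cy cA' eqxx.
Qed.

Lemma card_basis B : B \in bases M -> #|B| = rank M.
Proof.
move=> BM; apply/eqP; rewrite eqn_leq; apply/andP; split.
  exact: (leq_bigmax_cond (F := fun B => #|B|)).
by apply/bigmax_leqP => A AM; apply: card_bases_leq.
Qed.

Lemma rk0 : rk set0 = 0.
Proof. by apply/eqP; rewrite -leqn0; apply/bigmax_leqP => B _; rewrite setI0 cards0. Qed.

Lemma rkT : rk setT = rank M.
Proof. by apply: eq_bigr => B _; rewrite setIT. Qed.

Lemma rk_leq_card S : rk S <= #|S|.
Proof. by apply/bigmax_leqP => B _; apply/subset_leq_card/subsetIr. Qed.

Lemma rk_leq_rank S : rk S <= rank M.
Proof.
apply/bigmax_leqP => B BM; rewrite -(card_basis BM).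
by apply/subset_leq_card/subsetIl.
Qed.

(** Among the bases attaining [rk X], take the one with largest overlap with a basis B attaining
    [rk Y]. Its elements outside [Y] all lie in B, since exchanging one away would not lose anything
    in [X]; so it has at most as many elements outside [Y] as B, and at least as many inside. *)
Lemma rk_chain X Y : X \subset Y ->
  exists B, [/\ B \in bases M, #|B :&: X| = rk X & #|B :&: Y| = rk Y].
Proof.
move=> XY; have [A0 A0M eA0] := rk_attained X; have [B BM eB] := rk_attained Y.
have [A /andP[AM /eqP cA] maxA] := @arg_maxnP _ A0
  (fun A => (A \in bases M) && (#|A :&: X| == rk X)) (fun A => #|A :&: B|)
  (introT andP (conj A0M (introT eqP eA0))).
exists A; split=> //; apply/eqP; rewrite eqn_leq rk_ge //=.
have sAB : A :\: Y \subset B :\: Y.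
  apply/subsetP => x; rewrite !inE => /andP[xY xA]; rewrite xY /=.
  apply: contraT => xB.
  have [|y [_ yM cy]] := @bases_exchange_closer A B x AM BM; first by rewrite inE xB.
  apply: contraTT => _; rewrite -leqNgt; apply: maxA; rewrite yM /=.
  rewrite eqn_leq rk_ge //= -cA; apply/subset_leq_card/subsetP => z.
  rewrite !inE => /andP[zA zX]; rewrite zA zX !andbT /=.
  by apply/orP; right; apply: contraNneq xY => <-; apply: (subsetP XY).
have := subset_leq_card sAB; rewrite !cardsD (card_basis AM) (card_basis BM) -eB.
have := subset_leq_card (subsetIl A Y); have := subset_leq_card (subsetIl B Y).
rewrite (card_basis AM) (card_basis BM); lia.
Qed.

(** For one basis attaining both ranks on the left, cardinality is modular, and each term on the
    right only grows. *)
Lemma rk_submod S T : rk (S :|: T) + rk (S :&: T) <= rk S + rk T.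
Proof.
have [|B [BM <- <-]] := @rk_chain (S :&: T) (S :|: T).
  exact: subset_trans (subsetIl _ _) (subsetUl _ _).
rewrite setIUr -[B :&: (S :&: T)]/(_) (_ : B :&: (S :&: T) = (B :&: S) :&: (B :&: T)).
  by rewrite cardsUI leq_add // rk_ge.
by rewrite setIACA setIid.
Qed.

End MatroidRank.

(** * A linear form on set functions *)

Lemma harmonic0 : harmonic_number 0 = 0.
Proof. by rewrite /harmonic_number big_geq. Qed.

Lemma harmonicS k : harmonic_number k.+1 = harmonic_number k + (k.+1)%:R^-1.
Proof. by rewrite /harmonic_number big_nat_recr. Qed.

(** For 0 < s < n this is the Beta value B(s, n-s), the integral of x^(s-1) (1-x)^(n-s-1) over
    [0, 1]. *)
Definition weight (n s : nat) : rat := (s.-1)`!%:R * (n.-1 - s)`!%:R / (n.-1)`!%:R.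

Lemma weight_gt0 n s : 0 < weight n s.
Proof. by rewrite /weight !mulr_gt0 ?invr_gt0 ?ltr0n ?fact_gt0. Qed.

Lemma weight_compl n s : (0 < s < n)%N -> weight n (n - s) = weight n s.
Proof.
move=> h; rewrite /weight [(_)`!%:R * (_)`!%:R]mulrC.
by congr (_`!%:R * _`!%:R / _); lia.
Qed.

Lemma natr_fact k : k.+1`!%:R = k.+1%:R * k`!%:R :> rat.
Proof. by rewrite factS natrM. Qed.

Lemma fact_neq0 k : k`!%:R != 0 :> rat.
Proof. by rewrite pnatr_eq0 -lt0n fact_gt0. Qed.

(** Under the Beta integral this is x + (1-x) = 1. *)
Lemma weight_rec n s : (0 < s < n)%N -> weight n.+1 s + weight n.+1 s.+1 = weight n s.
Proof.
case: n => [|n]; first by lia.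
case: s => [|s] // /andP[_ sn]; rewrite /weight [n.+2.-1]/= [n.+1.-1]/=.
have [k ek] : exists k, (n = s.+1 + k)%N by exists (n - s.+1)%N; lia.
have -> : (n.+1 - s.+1 = k.+1)%N by lia.
have -> : (n.+1 - s.+2 = k)%N by lia.
have -> : (n - s.+1 = k)%N by lia.
rewrite [s.+1.-1]/= [s.+2.-1]/= !natr_fact.
have := fact_neq0 n; have n1 : n.+1%:R != 0 :> rat by rewrite pnatr_eq0.
have en : n.+1%:R = s.+1%:R + k.+1%:R :> rat by rewrite -natrD; congr _%:R; lia.
rewrite en => n0; rewrite en in n1.
by move: (s.+1%:R) (k.+1%:R) n1 => a b n1; field; rewrite n0 n1.
Qed.

Lemma weight1 n : weight n.+2 1 = n.+1%:R^-1.
Proof.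
rewrite /weight /= fact0 mul1r subn1 /= natr_fact invfM mulrCA divff ?mulr1 //.
exact: fact_neq0.
Qed.

(** Total weight of the sets of size [s]: n / (s (n-s)), in the partial fractions from which
    harmonic numbers arise. *)
Lemma weight_binomial n s : (0 < s < n)%N ->
  'C(n, s)%:R * weight n s = s%:R^-1 + (n - s)%:R^-1.
Proof.
case: s => [|s] //; case: n => [|n] // /andP[_ ltsn].
have [k ek] : exists k, (n = s + k.+1)%N by exists (n - s.+1)%N; lia.
have := bin_fact (ltnW ltsn); rewrite /weight [n.+1.-1]/= [s.+1.-1]/=.
have -> : (n - s.+1 = k)%N by lia.
have -> : (n.+1 - s.+1 = k.+1)%N by lia.
have := fact_neq0 n; have := fact_neq0 s; have := fact_neq0 k.
have s1 : s.+1%:R != 0 :> rat by rewrite pnatr_eq0.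
have k1 : k.+1%:R != 0 :> rat by rewrite pnatr_eq0.
have en : n.+1%:R = s.+1%:R + k.+1%:R :> rat by rewrite -natrD; congr _%:R; lia.
move=> k0 s0 n0 /(congr1 (fun i : nat => i%:R : rat)).
rewrite [LHS]natrM [X in _ * X]natrM !natr_fact => e.
have -> : 'C(n.+1, s.+1)%:R = n.+1%:R * n`!%:R / (s.+1%:R * s`!%:R * (k.+1%:R * k`!%:R)) :> rat.
  by rewrite -e mulfK // !mulf_neq0.
rewrite en; move: (s.+1%:R) (k.+1%:R) s1 k1 => a b a0 b0.
by field; rewrite k0 s0 n0 a0 b0.
Qed.

Lemma big_subset_setU1 (T : finType) (R : nmodType) (F : {set T} -> R) i (B : {set T}) :
  i \notin B ->
  \sum_(S : {set T} | S \subset i |: B) F S =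
  \sum_(S : {set T} | S \subset B) F S + \sum_(S : {set T} | S \subset B) F (i |: S).
Proof.
move=> iB; rewrite (bigID (fun S : {set T} => i \notin S)) /=; congr (_ + _).
  apply: eq_bigl => S; apply/andP/idP => [[/subsetP sS iS]|sS].
    apply/subsetP => x xS; have := sS x xS; rewrite !inE.
    by case/orP => // /eqP xi; rewrite -xi xS in iS.
  split; first by apply: subset_trans sS (subsetUr _ _).
  by apply: contra iB; apply: (subsetP sS).
rewrite (reindex_onto (fun S => i |: S) (fun S => S :\ i)) /=; last first.
  by move=> S /andP[_]; rewrite negbK; apply: setD1K.
apply: eq_bigl => S; rewrite !inE eqxx /= andbT.
apply/andP/idP => [[/subsetP sS /eqP e]|sS].
  apply/subsetP => x; rewrite -e => xS; have := sS x; move: xS.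
  by rewrite !inE => /andP[/negPf -> /= ->] /(_ isT).
split; first exact: setUS.
by apply/eqP/setU1K; apply: contra iB; apply: (subsetP sS).
Qed.

(** Pairing S with [i |: S], [weight_rec] merges the two weights into one for [N - 1]; each element
    of [B] thus lowers [N] by one. *)
Lemma sum_weight_shift (T : finType) (B : {set T}) N t : (0 < t)%N -> (#|B| + t < N)%N ->
  \sum_(S : {set T} | S \subset B) weight N (#|S| + t) = weight (N - #|B|) t.
Proof.
move=> t0; move eb: #|B| => b; elim: b B N t t0 eb => [|b IHb] B N t t0 eb lt.
  rewrite (big_pred1 finset.set0) ?cards0 ?subn0 // => S.
  by rewrite (cards0_eq eb) subset0.
have /card_gt0P[i iB] : (0 < #|B|)%N by rewrite eb.
have iB' : i \notin B :\ i by rewrite !inE eqxx.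
have cB' : #|B :\ i| = b by have := cardsD1 i B; rewrite iB eb => -[->].
rewrite -(setD1K iB) big_subset_setU1 // -big_split /=.
case: N lt => [|N] lt; first by lia.
rewrite -(IHb _ N t t0 cB'); last by lia.
apply: eq_bigr => S sS; have := subset_leq_card sS; rewrite cB' => cS.
rewrite cardsU1 (contra (subsetP sS i) iB') /= add1n addSn weight_rec //; lia.
Qed.

(** Adding an element to a set of size b brings new subsets of total weight [weight (N - b) 1] =
    1/(N-b-1); these reciprocals add up to the difference. *)
Lemma sum_weight_subsets (T : finType) (B : {set T}) N : (#|B| < N)%N ->
  \sum_(S : {set T} | (S \subset B) && (S != finset.set0)) weight N #|S| =
  harmonic_number N.-1 - harmonic_number (N - #|B|).-1.
Proof.
move eb: #|B| => b; elim: b B eb => [|b IHb] B eb lt.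
  rewrite big1 ?subn0 ?subrr // => S /andP[].
  by rewrite (cards0_eq eb) subset0 => ->.
have /card_gt0P[i iB] : (0 < #|B|)%N by rewrite eb.
have iB' : i \notin B :\ i by rewrite !inE eqxx.
have cB' : #|B :\ i| = b by have := cardsD1 i B; rewrite iB eb => -[->].
rewrite big_mkcondr -(setD1K iB) big_subset_setU1 // -big_mkcondr /= IHb //; last by lia.
have -> : \sum_(S : {set T} | S \subset B :\ i)
   (if i |: S != finset.set0 then weight N #|i |: S| else 0) =
   \sum_(S : {set T} | S \subset B :\ i) weight N (#|S| + 1).
  apply: eq_bigr => S sS; rewrite ifT ?cardsU1 ?(contra (subsetP sS i) iB') 1?addnC //.
  by apply/set0Pn; exists i; rewrite !inE eqxx.
rewrite sum_weight_shift ?cB' //; last by lia.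
have [k ->] : exists k, N = (k + b).+2 by exists (N - b.+2)%N; lia.
have -> : ((k + b).+2 - b = k.+2)%N by lia.
have -> : ((k + b).+2 - b.+1 = k.+1)%N by lia.
by rewrite weight1 /= [harmonic_number k.+1]harmonicS; ring.
Qed.

Section LinearForm.
Variable n : nat.
Implicit Types (f : {ffun {set 'I_n} -> int}) (A B S : {set 'I_n}).

Definition rank_form f : rat :=
  \sum_(S : {set 'I_n} | (0 < #|S| < n)%N) weight n #|S| * (f S)%:~R
  - harmonic_number n.-1 * (f finset.setT)%:~R.

Definition hits A : {ffun {set 'I_n} -> int} :=
  [ffun S : {set 'I_n} => ((S :&: A != finset.set0) : nat)%:Z].

Lemma rank_formD f g : rank_form (f + g) = rank_form f + rank_form g.
Proof.
rewrite /rank_form !ffunE intrD mulrDr opprD addrACA -big_split /=.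
by congr (_ + _); apply: eq_bigr => S _; rewrite !ffunE intrD mulrDr.
Qed.

Lemma card_leq_n S : (#|S| <= n)%N.
Proof. by rewrite (leq_trans (max_card _)) ?card_ord. Qed.

Lemma properE S : (0 < #|S| < n)%N = (S != finset.set0) && (S != finset.setT).
Proof.
rewrite card_gt0; congr (_ && _); have cS := card_leq_n S.
by rewrite ltn_neqAle cS andbT eqEcard subsetT cardsT card_ord -ltnNge ltn_neqAle cS andbT.
Qed.

(** Complementation preserves the weight and swaps the sets containing a fixed i with those avoiding
    it; each half is H_(n-1). *)
Lemma sum_weight_proper : (0 < n)%N ->
  \sum_(S : {set 'I_n} | (0 < #|S| < n)%N) weight n #|S| = harmonic_number n.-1 *+ 2.
Proof.
move=> n0; have [m em] : exists m, n = m.+1 by exists n.-1; lia.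
have i : 'I_n by exact: Ordinal n0.
have half : \sum_(S : {set 'I_n} | (0 < #|S| < n)%N && (i \notin S)) weight n #|S| =
    harmonic_number n.-1.
  have ci : #|~: [set i]| = n.-1 by rewrite cardsC1 card_ord.
  have := @sum_weight_subsets _ (~: [set i]) n; rewrite ci (_ : n - n.-1 = 1)%N; last by lia.
  rewrite /= harmonic0 subr0 => <-; last by lia.
  apply: eq_bigl => S; rewrite properE subsetC sub1set !inE andbC.
  case: (boolP (i \in S)) => //= iS; rewrite (_ : S != finset.setT) ?andbT //.
  by apply: contraNneq iS => ->; rewrite inE.
rewrite (bigID (fun S : {set 'I_n} => i \notin S)) /= half mulr2n; congr (_ + _).
rewrite -half (reindex_inj (inv_inj (@setCK _))) /=.
apply: eq_big => [S|S /andP[h _]].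
  by rewrite !inE negbK cardsCs setCK card_ord; congr (_ && _); have := card_leq_n S; move: #|S| => k; lia.
move: h; rewrite cardsCs setCK card_ord => h; rewrite weight_compl //; lia.
Qed.

(** Sets meeting [A] weigh the total 2 H_(n-1) minus the weight H_(n-1) - H_(|A|-1) of the nonempty
    sets avoiding [A]. *)
Lemma rank_form_hits A : A != finset.set0 ->
  rank_form (hits A) = harmonic_number #|A|.-1.
Proof.
move=> A0; have cA0 : (0 < #|A|)%N by rewrite card_gt0.
have cAn : (#|A| <= n)%N by exact: card_leq_n.
have n0 : (0 < n)%N by lia.
rewrite /rank_form !ffunE finset.setTI A0 mulr1.
have cC : #|~: A| = (n - #|A|)%N by rewrite cardsCs setCK card_ord.
have := @sum_weight_subsets _ (~: A) n; rewrite cC (_ : n - (n - #|A|) = #|A|)%N; last by lia.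
have := sum_weight_proper n0.
rewrite (bigID (fun S : {set 'I_n} => S :&: A != finset.set0)) /= => e1 e2.
have {}e2 : \sum_(S : {set 'I_n} | (0 < #|S| < n)%N && ~~ (S :&: A != finset.set0)) weight n #|S| =
   harmonic_number n.-1 - harmonic_number #|A|.-1.
  rewrite -e2; last by move: #|A| cA0 cAn n0 => k; lia.
  apply: eq_bigl => S; rewrite properE negbK setI_eq0 disjoints_subset andbC.
  case sS: (S \subset ~: A) => //=; rewrite (_ : S != finset.setT) ?andbT //.
  apply: contraTneq sS => ->; rewrite subTset; apply: contraNneq A0 => e.
  by rewrite -(setCK A) e finset.setCT.
rewrite (eq_bigr (fun S => if S :&: A != finset.set0 then weight n #|S| else 0)); last first.
  by move=> S _; rewrite ffunE; case: (_ != _); rewrite ?mulr1 ?mulr0.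
rewrite -big_mkcondr /=; move: e1; rewrite e2 mulr2n => /eqP.
by set X := \sum_(_ | _) _ => /eqP e; lra.
Qed.

(** Möbius inversion: the indicator of the subsets of B is the constant 1 minus [hits (~: B)], and
    these indicators are unitriangular in the point masses, so the span is already over the
    integers. *)
Lemma hits_span (D : {ffun {set 'I_n} -> int} -> rat) :
  (forall f g, D (f + g) = D f + D g) -> (forall A, A != finset.set0 -> D (hits A) = 0) ->
  forall f, f finset.set0 = 0 -> D f = 0.
Proof.
move=> Dadd Dhits f f0.
have D0 : D 0 = 0 by apply: (@addrI _ (D 0)); rewrite -Dadd !addr0.
have Dn g k : D (g *+ k) = D g *+ k.
  by elim: k => [|k IHk]; rewrite ?mulr0n // !mulrS Dadd IHk.
have DN g : D (- g) = - D g.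
  by apply: (@addrI _ (D g)); rewrite -Dadd !subrr.
have Dz g (z : int) : D (g *~ z) = D g *~ z.
  by case: z => k; rewrite /intmul ?DN Dn.
have Dsum I r (P : pred I) G : D (\sum_(i <- r | P i) G i) = \sum_(i <- r | P i) D (G i).
  by apply: (big_morph D Dadd D0).
pose delta A : {ffun {set 'I_n} -> int} := [ffun S => (S == A)%:R].
pose one : {ffun {set 'I_n} -> int} := [ffun _ => 1].
(* The correction makes [D'] kill the constant [one], which is no combination of the [hits A] as
   they vanish at the empty set. *)
pose D' g := D g - D one *~ g finset.set0.
have D'add g h : D' (g + h) = D' g + D' h.
  by rewrite /D' Dadd ffunE mulrzDr; ring.
have D'0 : D' 0 = 0 by rewrite /D' D0 ffunE mulr0z subrr.
have D'sum I r (P : pred I) G : D' (\sum_(i <- r | P i) G i) = \sum_(i <- r | P i) D' (G i).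
  by apply: (big_morph D' D'add D'0).
have D'zeta B : D' (\sum_(S : {set 'I_n} | S \subset B) delta S) = 0.
  have -> : \sum_(S : {set 'I_n} | S \subset B) delta S = one - hits (~: B).
    apply/ffunP => S; rewrite sum_ffunE !ffunE setI_eq0 disjoints_subset setCK.
    case: (boolP (S \subset B)) => sS.
      rewrite (bigD1 S) //= ffunE eqxx big1 ?addr0 ?subr0 // => T /andP[_ TS].
      by rewrite ffunE eq_sym (negPf TS).
    rewrite big1 ?subrr // => T sT; rewrite ffunE.
    by case: eqP => // e; rewrite e sT in sS.
  rewrite /D' Dadd DN !ffunE finset.set0I eqxx subr0 mulr1z.
  have [e|/Dhits ->] := eqVneq (~: B) finset.set0; last by rewrite subr0 subrr.
  rewrite (_ : hits _ = 0) ?D0 ?subr0 ?subrr //.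
  by apply/ffunP => S; rewrite !ffunE e finset.setI0 eqxx.
have D'delta B : D' (delta B) = 0.
  move eb: #|B| => b; elim/ltn_ind: b B eb => b IHb B eb.
  have := D'zeta B; rewrite (bigD1 B) //= D'add D'sum big1 ?addr0 // => S /andP[sS SB].
  apply: (IHb #|S|) => //; rewrite -eb; apply: proper_card.
  by rewrite properEneq SB.
have D'f : D' f = 0.
  have -> : f = \sum_(S : {set 'I_n}) delta S *~ f S.
    apply/ffunP => S; rewrite sum_ffunE (bigD1 S) //= big1 => [|T TS].
      by rewrite addr0 ffunMzE ffunE eqxx intz.
    by rewrite ffunMzE ffunE eq_sym (negPf TS) mul0rz.
  rewrite D'sum big1 // => S _.
  have D'z g (z : int) : D' (g *~ z) = D' g *~ z.
    by rewrite /D' Dz ffunMzE mulrzBl -!mulrzA mulrC mulrzz mulrC.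
  by rewrite D'z D'delta mul0rz.
by move: D'f; rewrite /D' f0 mulr0z subr0.
Qed.

End LinearForm.

(** * Bounds on the linear form at a rank function *)

Section RankFormBounds.
Variable n : nat.
Implicit Types (f g : {ffun {set 'I_n} -> int}) (A B S : {set 'I_n}).

Lemma rank_formB f g : g finset.setT = f finset.setT ->
  rank_form g - rank_form f =
  \sum_(S : {set 'I_n} | (0 < #|S| < n)%N) weight n #|S| * (g S - f S)%:~R.
Proof.
move=> efg; rewrite /rank_form efg opprB addrA subrK -sumrB.
by apply: eq_bigr => S _; rewrite intrB mulrBr.
Qed.

Lemma rank_form_le f g : g finset.setT = f finset.setT ->
  (forall S, (0 < #|S| < n)%N -> f S <= g S) -> rank_form f <= rank_form g.
Proof.
move=> efg le_fg; rewrite -subr_ge0 rank_formB //; apply: sumr_ge0 => S hS.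
by rewrite mulr_ge0 ?(ltW (weight_gt0 _ _)) // ler0z subr_ge0 le_fg.
Qed.

Lemma rank_form_eq f g : g finset.setT = f finset.setT ->
  (forall S, (0 < #|S| < n)%N -> f S <= g S) ->
  rank_form f = rank_form g -> forall S, (0 < #|S| < n)%N -> f S = g S.
Proof.
move=> efg le_fg /esym/eqP; rewrite -subr_eq0 rank_formB // => /eqP e S hS.
have h (T : {set 'I_n}) : (0 < #|T| < n)%N -> 0 <= weight n #|T| * (g T - f T)%:~R.
  by move=> hT; rewrite mulr_ge0 ?(ltW (weight_gt0 _ _)) // ler0z subr_ge0 le_fg.
have /eqP := psumr_eq0P h e hS.
by rewrite mulf_eq0 (gt_eqF (weight_gt0 _ _)) intr_eq0 subr_eq0 => /eqP.
Qed.

(** Layers of equal size are peeled off from below; the layer of size r+1 weighs 1/(r+1) +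
    1/(n-r-1). *)
Lemma sum_weight_gt r : (r < n)%N ->
  \sum_(S : {set 'I_n} | (r < #|S| < n)%N) weight n #|S| =
  harmonic_number n.-1 - harmonic_number r + harmonic_number (n - r).-1.
Proof.
move ej: (n.-1 - r)%N => j; elim: j r ej => [|j IHj] r ej ltrn.
  have -> : r = n.-1 by lia.
  rewrite subrr add0r (_ : (n - n.-1).-1 = 0)%N; last by lia.
  by rewrite harmonic0 big1 // => S; lia.
rewrite (bigID (fun S : {set 'I_n} => #|S| == r.+1)) /=.
have -> : \sum_(S : {set 'I_n} | (r < #|S| < n)%N && (#|S| == r.+1)) weight n #|S| =
    r.+1%:R^-1 + (n - r.+1)%:R^-1.
  rewrite -weight_binomial; last by lia.
  rewrite -[in 'C(_, _)](card_ord n) -card_draws -sum1_card natr_sum big_distrl /=.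
  apply: eq_big => [S|S /andP[_ /eqP ->]]; last by rewrite mul1r.
  by rewrite !inE; case: eqP => [->|]; rewrite ?andbF ?andbT //; lia.
have -> : \sum_(S : {set 'I_n} | (r < #|S| < n)%N && (#|S| != r.+1)) weight n #|S| =
    \sum_(S : {set 'I_n} | (r.+1 < #|S| < n)%N) weight n #|S|.
  by apply: eq_bigl => S; move: #|S| => k; lia.
rewrite IHj; [|lia|lia].
have [k ek] : exists k, (n = r.+1 + k.+1)%N by exists (n - r.+2)%N; lia.
have -> : (n - r.+1 = k.+1)%N by lia.
have -> : (n - r = k.+2)%N by lia.
by rewrite /= [harmonic_number r.+1]harmonicS [harmonic_number k.+1]harmonicS; ring.
Qed.

Definition uniform_rank r : {ffun {set 'I_n} -> int} :=
  [ffun S : {set 'I_n} => (minn #|S| r)%:Z].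

Lemma rank_form0 : rank_form (0 : {ffun {set 'I_n} -> int}) = 0.
Proof. by apply: (addrI (rank_form (0 : {ffun {set 'I_n} -> int}))); rewrite -rank_formD !addr0. Qed.

(** Passing from rank r to r+1 raises the function by one exactly on the sets of size above r, which
    changes the form by H_(n-r-1) - H_r. *)
Lemma rank_form_uniform r : (r <= n)%N ->
  rank_form (uniform_rank r) = n%:R * harmonic_number n - r%:R * harmonic_number r
               - (n - r)%:R * harmonic_number (n - r).
Proof.
elim: r => [|r IHr] lern.
  have -> : uniform_rank 0 = 0 by apply/ffunP => S; rewrite !ffunE minn0.
  by rewrite rank_form0 subn0 mul0r subr0 subrr.
rewrite -[LHS](subrK (rank_form (uniform_rank r))) [X in _ + X]IHr; last by lia.
rewrite /rank_form opprD opprK [X in X + _ = _]addrACA -sumrB.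
rewrite !ffunE !cardsT !card_ord (minn_idPr lern) (minn_idPr (ltnW lern)).
have -> : \sum_(S : {set 'I_n} | (0 < #|S| < n)%N)
    (weight n #|S| * (uniform_rank r.+1 S)%:~R - weight n #|S| * (uniform_rank r S)%:~R)
  = \sum_(S : {set 'I_n} | (r < #|S| < n)%N) weight n #|S|.
  rewrite (eq_bigr (fun S : {set 'I_n} => if (r < #|S|)%N then weight n #|S| else 0)).
    rewrite -big_mkcondr; apply: eq_bigl => S; move: #|S| => k; lia.
  move=> S _; rewrite -mulrBr !ffunE -intrB; case: ltnP => h.
    rewrite (minn_idPr h) (_ : (_ - _)%R = 1) ?mulr1 //; lia.
  by rewrite (minn_idPl (leqW h)) subrr mulr0.
rewrite sum_weight_gt //.
have [k ek] : exists k, (n = r + k.+1)%N by exists (n - r.+1)%N; lia.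
have -> : (n - r = k.+1)%N by lia.
have -> : (n - r.+1 = k)%N by lia.
have k1 : k.+1%:R != 0 :> rat by rewrite pnatr_eq0.
have r1 : r.+1%:R != 0 :> rat by rewrite pnatr_eq0.
rewrite /= !harmonicS -!pmulrn -!natr1 in k1 r1 *.
by field; rewrite k1 r1.
Qed.

Definition basis_rank B : {ffun {set 'I_n} -> int} :=
  [ffun S : {set 'I_n} => #|B :&: S|%:Z].

(** The function is the sum of [hits [set i]] over i in [B], each of value H_0 = 0. *)
Lemma rank_form_basis B : rank_form (basis_rank B) = 0.
Proof.
have -> : basis_rank B = \sum_(i in B) hits [set i].
  apply/ffunP => S; rewrite sum_ffunE ffunE -sum1_card -natz natr_sum.
  rewrite big_mkcond [RHS]big_mkcond; apply: eq_bigr => i _; rewrite inE ffunE.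
  case: (i \in B) => //=; rewrite setI_eq0 disjoint_sym disjoints1.
  by case: (i \in S).
rewrite (big_morph (@rank_form n) (@rank_formD n) rank_form0) big1 // => i _.
rewrite rank_form_hits ?cards1 ?harmonic0 //.
by apply/set0Pn; exists i; rewrite inE.
Qed.

Lemma ex_subset_card A k : (k <= #|A|)%N -> exists2 X : {set 'I_n}, X \subset A & #|X| = k.
Proof.
rewrite -bin_gt0 -cards_draws => /card_gt0P[X].
by rewrite inE => /andP[XA /eqP cX]; exists X.
Qed.

Variable M : matroid 'I_n.

Definition rkf : {ffun {set 'I_n} -> int} := [ffun S : {set 'I_n} => (rk M S)%:Z].

Lemma rank_form_rk_ge0 : 0 <= rank_form rkf.
Proof.
have [B BM] := ex_basis M; rewrite -(rank_form_basis B); apply: rank_form_le.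
  by rewrite !ffunE rkT finset.setIT (card_basis BM).
by move=> S _; rewrite !ffunE lez_nat rk_ge.
Qed.

Lemma rank_form_rk_le : rank_form rkf <= rank_form (uniform_rank (rank M)).
Proof.
apply: rank_form_le; last by move=> S _; rewrite !ffunE lez_nat leq_min rk_leq_card rk_leq_rank.
by rewrite !ffunE rkT (minn_idPr _) // -rkT rk_leq_card.
Qed.

(** Equality on singletons makes every element outside [B] a loop, so no basis leaves [B]. *)
Lemma rank_form_rk_eq0 B : B \in bases M -> rank_form rkf = 0 <-> bases M = [set B].
Proof.
move=> BM; split=> [e|eM]; last first.
  rewrite -(rank_form_basis B); congr rank_form; apply/ffunP => S.
  by rewrite !ffunE /rk eM big_set1.
have h : forall S, (0 < #|S| < n)%N -> basis_rank B S = rkf S.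
  apply: rank_form_eq; last by rewrite e rank_form_basis.
    by rewrite !ffunE rkT finset.setIT (card_basis BM).
  by move=> S _; rewrite !ffunE lez_nat rk_ge.
apply/finset.setP => A; rewrite in_set1; apply/idP/eqP => [AM|-> //].
apply/eqP; rewrite eqEcard (card_basis AM) (card_basis BM) leqnn andbT.
apply/subsetP => i iA; apply: contraT => iB.
(* The singleton is proper: [B] is nonempty, having the size of [A], and misses i. *)
have /h : (0 < #|[set i]| < n)%N.
  rewrite cards1 /=; apply: leq_trans (card_leq_n (A :|: B)).
  have : (#|B| < #|A :|: B|)%N.
    by apply: proper_card; apply/properP; split; [exact: subsetUr | exists i; rewrite ?inE ?iA].
  rewrite (card_basis BM) -(card_basis AM); apply: leq_ltn_trans.
  by apply/card_gt0P; exists i.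
rewrite !ffunE => -[] eB; have := rk_ge [set i] AM; rewrite -eB.
have -> : A :&: [set i] = [set i] by apply/setIidPr; rewrite sub1set.
suff -> : B :&: [set i] = finset.set0 by rewrite cards1 cards0.
by apply: disjoint_setI0; rewrite disjoint_sym disjoints1.
Qed.

(** Equality at a set of size [rank M] makes it a basis. Conversely, a smaller set extends to one of
    that size and a larger one contains one. *)
Lemma rank_form_rk_eq_uniform :
  rank_form rkf = rank_form (uniform_rank (rank M)) <->
  bases M = [set B : {set 'I_n} | #|B| == rank M].
Proof.
split=> [e|eM].
  have h : forall S, (0 < #|S| < n)%N -> rkf S = uniform_rank (rank M) S.
    apply: rank_form_eq e.
      by rewrite !ffunE rkT (minn_idPr _) // -rkT rk_leq_card.
    by move=> S _; rewrite !ffunE lez_nat leq_min rk_leq_card rk_leq_rank.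
  apply/finset.setP => B; rewrite inE; apply/idP/eqP => [/card_basis //|cB].
  have [A AM] := ex_basis M.
  have cA := card_basis AM.
  have [hB|hB] := boolP (0 < #|B| < n)%N.
    move/h: (hB); rewrite !ffunE cB minnn => -[rB].
    have [A' A'M] := rk_attained M B; rewrite rB => cA'.
    suff <- : A' = B by [].
    apply/eqP; rewrite eqEcard cB (card_basis A'M) leqnn andbT.
    by apply/setIidPl/eqP; rewrite eqEcard finset.subsetIl (card_basis A'M) cA' leqnn !andbT.
   suff <- : A = B by [].
  (* Nothing is known at the empty and the full set, but each is the only set of its size, hence the
     basis [A]. *)
  have {}hB : #|B| = 0%N \/ #|B| = n by have := card_leq_n B; move: hB; move: #|B| => k; lia.
  case: hB => eB.
    by rewrite (cards0_eq eB); apply: cards0_eq; rewrite cA -cB.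
  have full (X : {set 'I_n}) : #|X| = n -> X = finset.setT.
    by move=> eX; apply/eqP; rewrite eqEcard subsetT cardsT card_ord eX leqnn.
  by rewrite (full B) // (full A) // cA -cB.
congr rank_form; apply/ffunP => S; rewrite !ffunE; congr Posz; apply/eqP.
rewrite eqn_leq leq_min rk_leq_card rk_leq_rank /=.
have lern : (rank M <= n)%N by rewrite -rkT (leq_trans (rk_leq_card _ _)) ?card_leq_n.
have [leS|ltS] := leqP #|S| (rank M).
  have [|X XS cX] := @ex_subset_card (~: S) (rank M - #|S|)%N.
    by rewrite [#|~: S|]cardsCs setCK card_ord leq_sub2r.
  have BM : S :|: X \in bases M.
    rewrite eM inE cardsU cX (_ : S :&: X = finset.set0) ?cards0; first by lia.
    by apply: disjoint_setI0; rewrite disjoint_sym disjoints_subset.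
  have := rk_ge S BM.
  by rewrite (_ : _ :&: S = S) //; apply/setIidPr/subsetUl.
have [|X XS cX] := @ex_subset_card S (rank M); first exact: ltnW.
have BM : X \in bases M by rewrite eM inE cX.
have := rk_ge S BM.
by rewrite (_ : X :&: S = X) ?cX //; apply/setIidPl.
Qed.

End RankFormBounds.

(** * Counting integer points of base polytopes *)

From mathcomp Require Import finmap boolp classical_sets cardinality convex.
From mathcomp Require Import interval_inference.
Local Open Scope classical_set_scope.

Section Counting.
Implicit Types (T U : choiceType).

Definition cnt T (X : set T) : nat := #|` fset_set X|%fset.

Lemma card_eq_cnt T (X : set T) : finite_set X -> (X #= `I_(cnt X))%card.
Proof. by move=> fX; rewrite -[X in (X #= _)%card]fset_setK //; apply/card_eq_fsetP. Qed.

Lemma cnt_image T U (X : set T) (f : T -> U) : finite_set X ->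
  (forall x y, X x -> X y -> f x = f y -> x = y) -> cnt (f @` X) = cnt X.
Proof.
move=> fX inj_f; rewrite /cnt fset_set_image //; apply: card_in_imfset => x y /=.
by rewrite !in_fset_set // !inE; apply: inj_f.
Qed.

Lemma cntU T (X Y : set T) : finite_set X -> finite_set Y ->
  (forall x, X x -> Y x -> False) -> cnt (X `|` Y) = (cnt X + cnt Y)%N.
Proof.
move=> fX fY disj; rewrite /cnt fset_setU // cardfsU -fset_setI //.
have -> : X `&` Y = set0.
  by apply/seteqP; split=> x //= [Xx Yx]; case: (disj x).
by rewrite fset_set0 cardfs0 subn0.
Qed.

Lemma cntX T U (X : set T) (Y : set U) : finite_set X -> finite_set Y ->
  cnt (X `*` Y) = (cnt X * cnt Y)%N.
Proof.
move=> fX fY; rewrite /cnt fset_setX // -(size_allpairs pair); apply: perm_size.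
apply: uniq_perm => [||[x y]]; first exact: fset_uniq.
  by apply: allpairs_uniq; rewrite ?fset_uniq // => -[? ?] [? ?].
rewrite -[LHS]/(_ \in (_ `*` _)%fset) in_fsetM /=.
apply/andP/allpairsP => [[hx hy]|[[x' y'] [hx hy [-> ->]]]]; last by split.
by exists (x, y); split.
Qed.

Lemma cnt1 T (x : T) : cnt [set x] = 1%N.
Proof. by rewrite /cnt fset_set1 cardfs1. Qed.

End Counting.

Section Polymatroid.
Variable n : nat.
Implicit Types (A S T : {set 'I_n}) (f g h : {ffun {set 'I_n} -> int}) (x y z : 'rV[int]_n).

Definition xsum (R : numDomainType) (x : 'rV[R]_n) (S : {set 'I_n}) : R := \sum_(i in S) x 0 i.

(** Ground sets are subsets [A] of one fixed type, with zero coordinates outside, so that faces and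
    projections stay in the same space; the ring is a parameter to serve both integer and real
    points. *)
Definition base_polytope (R : numDomainType) A f : set 'rV[R]_n :=
  [set x : 'rV[R]_n | [/\ forall i, i \notin A -> x 0 i = 0,
               forall S, S \subset A -> xsum x S <= (f S)%:~R
             & xsum x A = (f A)%:~R]].

Definition pts A f : set 'rV[int]_n := @base_polytope int A f.

Definition submod A f : Prop := f finset.set0 = 0 /\
  forall S T, S \subset A -> T \subset A -> f (S :|: T)%SET + f (S :&: T)%SET <= f S + f T.

Section xsum.
Variable R : numDomainType.
Implicit Types (u v : 'rV[R]_n).

Lemma xsum0 u : xsum u finset.set0 = 0.
Proof. by rewrite /xsum big_set0. Qed.

Lemma xsum1 u i : xsum u [set i]%SET = u 0 i.
Proof. by rewrite /xsum big_set1. Qed.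

Lemma xsumD u v S : xsum (u + v) S = xsum u S + xsum v S.
Proof. by rewrite /xsum -big_split; apply: eq_bigr => i _; rewrite mxE. Qed.

Lemma xsumZ a u S : xsum (a *: u) S = a * xsum u S.
Proof. by rewrite /xsum big_distrr; apply: eq_bigr => i _; rewrite mxE. Qed.

Lemma xsumB u v S : xsum (u - v) S = xsum u S - xsum v S.
Proof. by rewrite -scaleN1r xsumD xsumZ mulN1r. Qed.

Lemma xsum_delta i S : xsum (delta_mx 0 i : 'rV[R]_n) S = (i \in S)%:R.
Proof.
rewrite /xsum (eq_bigr (fun j => if j == i then 1 else 0)); last first.
  by move=> j _; rewrite mxE eqxx; case: eqP.
rewrite -big_mkcondr /=; case: (boolP (i \in S)) => iS.
  by rewrite (big_pred1 i) // => j /=; case: eqP => [->|]; rewrite ?iS ?andbF.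
by rewrite big_pred0 // => j; case: eqP => [->|]; rewrite ?(negPf iS) ?andbF.
Qed.

Lemma xsumUI u S T : xsum u (S :|: T)%SET + xsum u (S :&: T)%SET = xsum u S + xsum u T.
Proof.
rewrite /xsum !(big_mkcond (fun i => i \in _)) /= -!big_split; apply: eq_bigr => i _ /=.
by rewrite !inE; case: (i \in S); case: (i \in T); rewrite /= ?addr0 ?add0r.
Qed.

Lemma xsumD1 u S i : i \in S -> xsum u S = u 0 i + xsum u (S :\ i)%SET.
Proof. by move=> iS; rewrite /xsum (big_setD1 i). Qed.

Lemma xsumID u S T : xsum u S = xsum u (S :&: T)%SET + xsum u (S :\: T)%SET.
Proof. exact: big_setID. Qed.

Lemma xsum_eq0 u S : (forall i, i \in S -> u 0 i = 0) -> xsum u S = 0.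
Proof. by move=> h; apply: big1. Qed.

Lemma eq_xsum u v S : (forall i, i \in S -> u 0 i = v 0 i) -> xsum u S = xsum v S.
Proof. exact: eq_bigr. Qed.

End xsum.

Lemma ptsP A f x : pts A f x <->
  [/\ forall i, i \notin A -> x 0 i = 0, forall S, S \subset A -> xsum x S <= f S
     & xsum x A = f A].
Proof.
rewrite /pts /base_polytope /= intz.
by split=> -[x0 xle xeq]; split=> // S /xle; rewrite intz.
Qed.

(** Coordinates satisfy f(A) - f(A \ i) <= x_i <= f({i}), hence lie within 2B of zero for a crude
    common bound [B] of the values of [f]. *)
Lemma finite_pts A f : finite_set (pts A f).
Proof.
pose B := (\sum_(S : {set 'I_n}) `|f S|)%N.
have leB S : (`|f S| <= B)%N by rewrite /B (bigD1 S) //= leq_addr.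
pose enc (g : {ffun 'I_n -> 'I_(4 * B).+1}) : 'rV[int]_n := \row_i ((g i)%:Z - (2 * B)%:Z).
apply: (@sub_finite_set _ _ (enc @` setT)); last exact: finite_image.
move=> x /ptsP[x0 xle xeq].
have bnd i : - (2 * B)%:Z <= x 0 i <= (2 * B)%:Z.
  have [iA|/x0 ->] := boolP (i \in A); last by lia.
  have h1 := xle [set i]%SET; rewrite finset.sub1set xsum1 in h1.
  have h2 := xle (A :\ i)%SET (finset.subsetDl _ _).
  have h3 := xsumD1 x iA; rewrite xeq in h3.
  move: (h1 iA) h2 h3 (leB [set i]%SET) (leB A) (leB (A :\ i)%SET).
  move: (f [set i]%SET) (f A) (f (A :\ i)%SET) (x 0 i) (xsum x (A :\ i)%SET) => a b c d e; clear.
  by move: B => K; lia.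
exists [ffun i : 'I_n => inord `|(x 0 i + (2 * B)%:Z)%R|%N : 'I_(4 * B).+1] => //.
apply/rowP => i; rewrite !mxE ffunE; move: (bnd i); clear.
by move: (x 0 i) B => a K h; rewrite inordK; lia.
Qed.

Definition npts A f : nat := cnt (pts A f).

Lemma eq_npts A f g : (forall S, S \subset A -> f S = g S) -> npts A f = npts A g.
Proof.
move=> efg; congr cnt; apply/seteqP; split=> x /ptsP[x0 xle xeq]; apply/ptsP; split=> //.
- by move=> S SA; rewrite -efg ?xle.
- by rewrite -efg.
- by move=> S SA; rewrite efg ?xle.
- by rewrite efg.
Qed.

Lemma pts0 A : pts A 0 = [set 0].
Proof.
apply/seteqP; split=> x /=.
  move=> /ptsP[x0 xle xeq]; apply/rowP => i; rewrite mxE.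
  have [iA|/x0 //] := boolP (i \in A).
  have h1 := xle [set i]%SET; rewrite finset.sub1set xsum1 ffunE in h1.
  have h2 := xle (A :\ i)%SET (finset.subsetDl _ _); rewrite ffunE in h2.
  move: (h1 iA) h2 (xsumD1 x iA); rewrite xeq ffunE; clear.
  by move: (x 0 i) (xsum x _) => a b; lia.
move=> ->; apply/ptsP; split; first by move=> i _; rewrite mxE.
  by move=> S _; rewrite ffunE xsum_eq0 // => i _; rewrite mxE.
by rewrite ffunE xsum_eq0 // => i _; rewrite mxE.
Qed.

Lemma npts0 A : npts A 0 = 1%N.
Proof. by rewrite /npts pts0 cnt1. Qed.

(** The polytope is translated by t e_i; this serves to normalize f(A) to 0. *)
Lemma npts_translate A f i t : i \in A -> npts A (f + hits [set i]%SET *~ t) = npts A f.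
Proof.
move=> iA.
have mE S : (hits [set i]%SET *~ t) S = (i \in S)%:R * t.
  rewrite ffunMzE ffunE finset.setI_eq0 disjoint_sym disjoints1 negbK mulrzz natz.
  by case: (i \in S).
have xE x S : xsum (x + t *: delta_mx 0 i) S = xsum x S + (i \in S)%:R * t.
  by rewrite xsumD xsumZ xsum_delta mulrC.
rewrite /npts (_ : pts A (f + _) = (fun x => x + t *: delta_mx 0 i) @` pts A f).
  by rewrite cnt_image; [|exact: finite_pts|move=> x y _ _ /addIr].
apply/seteqP; split=> [x /ptsP[x0 xle xeq]|_ [x /ptsP[x0 xle xeq] <-]].
  exists (x - t *: delta_mx 0 i); last by rewrite subrK.
  apply/ptsP; split=> [j jA|S SA|].
  - rewrite !mxE x0 // eqxx; case: eqP => [ji|]; last by rewrite mulr0 subr0.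
    by rewrite ji iA in jA.
  - have := xle S SA; rewrite ffunE mE -[x in xsum x](subrK (t *: delta_mx 0 i)) xE; lra.
  - move: xeq; rewrite ffunE mE -[x in xsum x](subrK (t *: delta_mx 0 i)) xE; lra.
apply/ptsP; split=> [j jA|S SA|].
- rewrite !mxE x0 // eqxx; case: eqP => [ji|]; last by rewrite mulr0 addr0.
  by rewrite ji iA in jA.
- by rewrite xE !ffunE -mE lerD2r xle.
- by rewrite xE !ffunE -mE xeq.
Qed.

End Polymatroid.

(** * Faces and projections of base polytopes *)

Section Submodular.
Variable n : nat.
Implicit Types (A B S T U : {set 'I_n}) (f g h : {ffun {set 'I_n} -> int}) (x y z : 'rV[int]_n).

Lemma submod_sub A S f : S \subset A -> submod A f -> submod S f.
Proof.
move=> SA [f0 hf]; split=> // T U TS US.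
by apply: hf; [exact: fintype.subset_trans TS SA | exact: fintype.subset_trans US SA].
Qed.

Lemma submodD A f g : submod A f -> submod A g -> submod A (f + g).
Proof.
move=> [f0 hf] [g0 hg]; split=> [|S T SA TA]; first by rewrite !ffunE f0 g0.
by rewrite !ffunE addrACA [leRHS]addrACA lerD ?hf ?hg.
Qed.

Lemma submod0 A : submod A 0.
Proof. by split=> [|S T _ _]; rewrite !ffunE. Qed.

Lemma submodMn A f (k : nat) : submod A f -> submod A (f *+ k).
Proof.
by move=> hf; elim: k => [|k IHk]; rewrite ?mulr0n ?mulrS; [exact: submod0|exact: submodD].
Qed.

Definition contr S f : {ffun {set 'I_n} -> int} := [ffun T : {set 'I_n} => f (T :|: S)%SET - f S].

Lemma submod_contr A S f : S \subset A -> submod A f -> submod (A :\: S)%SET (contr S f).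
Proof.
move=> SA [f0 hf]; split=> [|T U TA UA]; first by rewrite ffunE finset.set0U subrr.
have sub (X : {set 'I_n}) : X \subset (A :\: S)%SET -> (X :|: S)%SET \subset A.
  move=> XA; rewrite finset.subUset SA andbT.
  by apply: fintype.subset_trans XA (finset.subsetDl _ _).
have := hf _ _ (sub _ TA) (sub _ UA).
rewrite !ffunE -finset.setUUl -finset.setUIl.
by set a := f _; set b := f _; set c := f _; set d := f _; lra.
Qed.

(** The element i stands for the pair i, j: this is the set function of the projection that adds
    coordinate j to coordinate i. *)
Definition merge i j f : {ffun {set 'I_n} -> int} :=
  [ffun T : {set 'I_n} => f (if i \in T then j |: T else T)%SET].

Lemma submod_merge A i j f : i \in A -> j \in A -> i != j -> submod A f ->
  submod (A :\ j)%SET (merge i j f).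
Proof.
move=> iA jA ij [f0 hf]; split=> [|T U TA UA]; first by rewrite ffunE inE.
have sub (X : {set 'I_n}) : X \subset (A :\ j)%SET -> (if i \in X then j |: X else X)%SET \subset A.
  move=> XA; have XA' := fintype.subset_trans XA (finset.subsetDl _ _).
  by case: ifP => // _; rewrite finset.subUset finset.sub1set jA.
have out (X : {set 'I_n}) : X \subset (A :\ j)%SET -> j \notin X.
  by move=> XA; apply/negP => /(fintype.subsetP XA); rewrite !inE eqxx.
have := hf _ _ (sub _ TA) (sub _ UA); rewrite !ffunE; congr (_ + _ <= _); congr (f _).
  apply/finset.setP => k; rewrite !inE.
  by case: (i \in T); case: (i \in U); rewrite /= !inE; case: (k == j); rewrite /= ?orbT.
have := out _ TA; have := out _ UA => jU jT.
apply/finset.setP => k; rewrite !inE.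
case: (i \in T); case: (i \in U); rewrite /= !inE //; case: eqVneq => [->|] //=;
  by rewrite ?(negPf jT) ?(negPf jU).
Qed.

(** For distinct i and j the base polytope of this function is the segment from 0 to e_i - e_j. *)
Definition cut i j : {ffun {set 'I_n} -> int} :=
  [ffun S : {set 'I_n} => ((i \in S) && (j \notin S) : nat)%:Z].

Lemma submod_cut A i j : submod A (cut i j).
Proof.
split=> [|S T _ _]; rewrite !ffunE !inE //.
by case: (i \in S); case: (i \in T); case: (j \in S); case: (j \in T).
Qed.

Definition single S : {ffun {set 'I_n} -> int} := [ffun T => (T == S)%:R].

Section Faces.
Variable R : numDomainType.
Implicit Types (u v w : 'rV[R]_n).

(** Outside [S] the tight constraint gives x(T) = x(T u S) - f(S), which is bounded by the
    contraction. *)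
Lemma face_split A S f u : S \subset A -> base_polytope A f u -> xsum u S = (f S)%:~R ->
  exists v w, [/\ base_polytope S f v, base_polytope (A :\: S)%SET (contr S f) w & u = v + w].
Proof.
move=> SA [u0 ule ueq] uS.
exists (\row_i if i \in S then u 0 i else 0), (\row_i if i \in S then 0 else u 0 i).
have DA : (A :\: S :|: S = A)%SET.
  apply/finset.setP => i; rewrite !inE.
  by have := fintype.subsetP SA i; case: (i \in S) => [/(_ isT) ->|_]; rewrite ?andbF ?orbF ?orbT.
have cE (T : {set 'I_n}) : T \subset (A :\: S)%SET ->
    xsum (\row_i (if i \in S then 0 else u 0 i)) T = xsum u (T :|: S)%SET - (f S)%:~R.
  move=> TA; have TS i : i \in T -> (i \in S) = false.
    by move=> /(fintype.subsetP TA); rewrite inE => /andP[/negPf].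
  have TS0 : (T :&: S)%SET = finset.set0.
    by apply/finset.setP => i; rewrite !inE; case: (boolP (i \in T)) => //= /TS.
  have := xsumUI u T S; rewrite TS0 xsum0 addr0 => ->.
  by rewrite uS addrK; apply: eq_xsum => i iT; rewrite mxE TS.
have sE (T : {set 'I_n}) : T \subset S -> xsum (\row_i (if i \in S then u 0 i else 0)) T = xsum u T.
  by move=> TS; apply: eq_xsum => i iT; rewrite mxE (fintype.subsetP TS).
split; [split|split|].
- by move=> i iS; rewrite mxE (negPf iS).
- by move=> T TS; rewrite sE // ule // (fintype.subset_trans TS).
- by rewrite sE.
- move=> i; rewrite !inE mxE negb_and negbK; case: (i \in S) => //= iA; exact: u0.
- move=> T TA; rewrite cE // ffunE intrB lerD2r ule // finset.subUset SA andbT.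
  exact: fintype.subset_trans TA (finset.subsetDl _ _).
- by rewrite cE // ffunE intrB DA ueq.
- by apply/rowP => i; rewrite !mxE; case: ifP; rewrite ?addr0 ?add0r.
Qed.

(** Submodularity gives the constraint at T: v(T n S) + w(T \ S) <= f(T n S) + f(T u S) - f(S) <=
    f(T). *)
Lemma face_join A S f v w : S \subset A -> submod A f ->
  base_polytope S f v -> base_polytope (A :\: S)%SET (contr S f) w ->
  base_polytope A f (v + w) /\ xsum (v + w) S = (f S)%:~R.
Proof.
move=> SA [f0 hf] [v0 vle veq] [w0 wle weq].
have vE T : xsum v T = xsum v (T :&: S)%SET.
  by rewrite (xsumID v T S) [X in _ + X]xsum_eq0 ?addr0 // => i; rewrite inE => /andP[/v0].
have wE T : xsum w T = xsum w (T :\: S)%SET.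
  rewrite (xsumID w T S) [X in X + _]xsum_eq0 ?add0r // => i.
  by rewrite inE => /andP[_ iS]; apply: w0; rewrite inE iS.
have ASA : (A :\: S :|: S = A)%SET.
  apply/finset.setP => i; rewrite !inE.
  by have := fintype.subsetP SA i; case: (i \in S) => [/(_ isT) ->|_]; rewrite ?andbF ?orbF ?orbT.
split; [split|].
- move=> i iA; rewrite mxE v0 ?w0 ?addr0 //; first by rewrite inE (negPf iA) andbF.
  by apply: contra iA; apply: (fintype.subsetP SA).
- move=> T TA; rewrite xsumD vE wE.
  have h1 := vle _ (finset.subsetIr T S); have h2 := wle _ (finset.setSD S TA).
  apply: (le_trans (lerD h1 h2)); rewrite -intrD ler_int ffunE.
  have -> : (T :\: S :|: S = T :|: S)%SET.
    by apply/finset.setP => i; rewrite !inE; case: (i \in S); rewrite ?orbT ?orbF.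
  by rewrite addrA lerBlDr [leLHS]addrC; apply: hf.
- rewrite xsumD vE wE weq (finset.setIidPr SA) veq -intrD ffunE ASA.
  by congr (_%:~R); rewrite addrC subrK.
- by rewrite xsumD veq wE finset.setDv xsum0 addr0.
Qed.

End Faces.

(** An integer point violating x(S) <= h(S) does so by exactly one, hence lies on the new face;
    [S != A] leaves the equation at [A] unchanged. *)
Lemma npts_face A S h : submod A (h + single S) -> S \subset A -> S != A ->
  npts A (h + single S) =
  (npts A h + npts S (h + single S)%R * npts (A :\: S)%SET (contr S (h + single S)%R))%N.
Proof.
set k := h + single S => hk SA SneA.
have kS : k S = h S + 1 by rewrite !ffunE eqxx.
have kT (T : {set 'I_n}) : T != S -> k T = h T by move=> TS; rewrite !ffunE (negPf TS) addr0.
pose F := (fun p => p.1 + p.2) @` (pts S k `*` pts (A :\: S)%SET (contr S k)).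
have finF : finite_set F by apply/finite_image/finite_setX; exact: finite_pts.
have FP x : F x <-> pts A k x /\ xsum x S = k S.
  split=> [[[v w] [/= hv hw] <-]|[hx xS]].
    by have := face_join SA hk hv hw; rewrite intz.
  have [|v [w [hv hw ->]]] := face_split SA hx; first by rewrite xS intz.
  by exists (v, w).
have -> : npts A k = cnt (pts A h `|` F).
  congr cnt; apply/seteqP; split=> x.
    move=> hx; have [xS|xS] := eqVneq (xsum x S) (k S); [by right; apply/FP|left].
    have /ptsP[x0 xle xeq] := hx; apply/ptsP; split => // [T TA|]; last by rewrite xeq kT // eq_sym.
    have [TS|/kT <-] := eqVneq T S; last exact: xle.
    move: xS (xle _ SA); rewrite TS kS; move: (xsum x S) (h S) => a b; lia.
  case=> [/ptsP[x0 xle xeq]|/FP[] //]; apply/ptsP; split => // [T TA|]; last by rewrite xeq kT // eq_sym.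
  have [TS|/kT ->] := eqVneq T S; last exact: xle.
  by move: (xle _ SA); rewrite TS kS; move: (xsum x S) (h S) => a b; lia.
rewrite cntU //; [|exact: finite_pts|]; last first.
  move=> x /ptsP[_ xle _] /FP[_ xS]; have := xle _ SA; rewrite xS kS.
  by move: (h S) => a; lia.
congr (_ + _)%N; rewrite cnt_image; last first.
- move=> [y z] [y' z'] [/= /ptsP[y0 _ _] /ptsP[z0 _ _]] [/= /ptsP[y0' _ _] /ptsP[z0' _ _]] /rowP e.
  have zS (i : 'I_n) : i \in S -> i \notin (A :\: S)%SET by rewrite inE => ->.
  congr pair; apply/rowP => i; have := e i; rewrite !mxE; case: (boolP (i \in S)) => iS.
  + by rewrite z0 ?z0' ?zS // !addr0.
  + by rewrite y0 ?y0'.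
  + by rewrite z0 ?z0' ?zS.
  + by rewrite y0 ?y0' // !add0r.
- by apply: finite_setX; exact: finite_pts.
by rewrite cntX //; exact: finite_pts.
Qed.

(* The new points are those on which some constraint [i \in S], [j \notin S]
   is violated by exactly one; projecting along e_i - e_j, each nonempty fibre
   contains exactly one of them, its end point. *)
Lemma npts_cut A i j f : i \in A -> j \in A -> i != j -> submod A f ->
  npts A (f + cut i j) = (npts A f + npts (A :\ j)%SET (merge i j f))%N.
Proof.
move=> iA jA ij hf; have [f0 fsub] := hf.
pose X := pts A (f + cut i j) `\` pts A f.
have finX : finite_set X by apply: finite_setD; exact: finite_pts.
pose d : 'rV[int]_n := delta_mx 0 i - delta_mx 0 j.
have dE S : xsum d S = (i \in S)%:R - (j \in S)%:R by rewrite xsumB !xsum_delta.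
have cutE S : (f + cut i j) S = f S + ((i \in S) && (j \notin S))%:R.
  by rewrite !ffunE natz.
have subP : pts A f `<=` pts A (f + cut i j).
  move=> x /ptsP[x0 xle xeq]; apply/ptsP; split=> // [S SA|].
    by rewrite cutE (le_trans (xle _ SA)) // lerDl.
  by rewrite cutE jA andbF addr0.
have -> : npts A (f + cut i j) = (npts A f + cnt X)%N.
  rewrite -cntU //; [|exact: finite_pts|by move=> x xP []].
  congr cnt; apply/seteqP; split=> x; last by case=> [/subP|[]].
  by have [|] := pselect (pts A f x); [left|right].
have XP x : X x -> exists S, [/\ S \subset A, i \in S, j \notin S & xsum x S = f S + 1].
  move=> [/ptsP[x0 xle xeq] xf]; apply: contrapT => noS; apply: xf; apply/ptsP; split=> // [S SA|].
    have := xle S SA; rewrite cutE; case: (boolP (_ && _)) => [/andP[iS jS]|_]; last by rewrite addr0.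
    have : xsum x S <> f S + 1 by move=> e; apply: noS; exists S.
    by move: (xsum x S) (f S) => a b; lia.
  by rewrite xeq cutE jA andbF addr0.
congr (_ + _)%N.
have d_j : d 0 j = -1 by rewrite !mxE !eqxx [j == i]eq_sym (negPf ij) sub0r.
have d_i : d 0 i = 1 by rewrite !mxE !eqxx (negPf ij) subr0.
have d_k (k : 'I_n) : k \notin A -> d 0 k = 0.
  move=> kA; rewrite !mxE /=; have ki : k != i by apply: contraNneq kA => ->.
  have kj : k != j by apply: contraNneq kA => ->.
  by rewrite (negPf ki) (negPf kj) subrr.
clearbody d.
pose pi (x : 'rV[int]_n) := x + x 0 j *: d.
have piE x S : xsum (pi x) S = xsum x S + x 0 j * ((i \in S)%:R - (j \in S)%:R).
  by rewrite xsumD xsumZ dE.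
rewrite /npts; suff <- : pi @` X = pts (A :\ j)%SET (merge i j f).
  rewrite cnt_image // => x y hx hy e.
  (* Moving a new point by t along d raises x(S) to f(S) + 1 + t on a violated set S, while f(S) + 1
     is the most allowed. *)
  have exy (u v : 'rV[int]_n) t : u = v + t *: d -> 0 <= t -> X u -> X v -> t = 0.
    move=> -> t0 /= hX /XP[S [SA iS jS yS]]; move: (hX.1) => /ptsP[_ xle _].
    have := xle S SA; rewrite xsumD xsumZ dE iS (negPf jS) subr0 mulr1 yS cutE iS jS /=.
    by move: (f S) t0 => a; lia.
  have ex : x = y + (y 0 j - x 0 j) *: d.
    by rewrite scalerBl addrA -[y + _]/(pi y) -e addrK.
  have ey : y = x + (x 0 j - y 0 j) *: d.
    by rewrite scalerBl addrA -[x + _]/(pi x) e addrK.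
  have [le|/ltW le] := leP 0 (y 0 j - x 0 j).
    by rewrite ex (exy _ _ _ ex le hx hy) scale0r addr0.
  rewrite ey (exy _ _ _ ey _ hy hx) ?scale0r ?addr0 //.
  by move: le; move: (y 0 j) (x 0 j) => a b; lia.
apply/seteqP; split=> [_ [x [/ptsP[x0 xle xeq] _] <-]|z /ptsP[z0 zle zeq]].
  apply/ptsP; split=> [k kA|T TA|].
  - have [->|kj] := eqVneq k j; first by rewrite !mxE d_j mulrN1 subrr.
    have kA' : k \notin A by apply: contra kA => kA; rewrite !inE kj.
    by rewrite !mxE (d_k _ kA') mulr0 addr0 x0.
  - have TA' : T \subset A by exact: fintype.subset_trans TA (finset.subsetDl _ _).
    have jT : j \notin T by apply/negP => /(fintype.subsetP TA); rewrite !inE eqxx.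
    rewrite piE (negPf jT) subr0 ffunE; case: (boolP (i \in T)) => iT; last first.
      have := xle T TA'; rewrite cutE (negPf iT) /= !addr0 mulr0 addr0; exact.
    have jTA : (j |: T)%SET \subset A by rewrite finset.subUset finset.sub1set jA.
    have := xle _ jTA; rewrite cutE !inE eqxx /= andbF addr0.
    by rewrite (xsumD1 x (finset.setU11 j T)) finset.setU1K // mulr1 addrC.
  - rewrite piE !inE eqxx ij iA /= subr0 mulr1 ffunE !inE ij iA /= finset.setD1K //.
    by have := xeq; rewrite cutE jA andbF addr0 => <-; rewrite (xsumD1 x jA) addrC.
have h1 : ([set i]%SET \subset A) && (i \in [set i]%SET) && (j \notin [set i]%SET).
  by rewrite finset.sub1set iA !inE eqxx eq_sym ij.
have [S /andP[/andP[SA iS] jS] maxS] := @Order.TotalTheory.arg_maxP _ _ _ [set i]%SET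
  (fun S : {set 'I_n} => (S \subset A) && (i \in S) && (j \notin S))
  (fun S => xsum z S - f S - 1) h1.
(* The least shift along -d after which all constraints separating i from j exceed [f] by at most
   one; the maximizer [S] exceeds it by exactly one. *)
set s := xsum z S - f S - 1 in maxS.
have zj : z 0 j = 0 by apply: z0; rewrite !inE eqxx.
have xE T : xsum (z - s *: d) T = xsum z T - s * ((i \in T)%:R - (j \in T)%:R).
  by rewrite xsumB xsumZ dE.
have zD T : xsum z T = xsum z (T :\ j)%SET.
  have [jT|jT] := boolP (j \in T); first by rewrite (xsumD1 z jT) zj add0r.
  by congr xsum; apply/esym/finset.setDidPl; rewrite disjoint_sym finset.disjoints1.
have subD (T : {set 'I_n}) : T \subset A -> (T :\ j)%SET \subset (A :\ j)%SET by exact: finset.setSD.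
have mE (T : {set 'I_n}) : i \in T -> j \in T -> merge i j f (T :\ j)%SET = f T.
  by move=> iT jT; rewrite ffunE !inE ij iT /= finset.setD1K.
exists (z - s *: d); last first.
  by rewrite /pi !mxE d_j zj mulrN1 sub0r opprK subrK.
split; last first.
  case/ptsP=> _ xle _; have := xle S SA; rewrite xE iS (negPf jS) subr0 mulr1 /s.
  by move: (xsum z S) (f S) => a b; lia.
apply/ptsP; split=> [k kA|T TA|].
- by rewrite !mxE (d_k _ kA) mulr0 subr0 z0 // !inE (negPf kA) andbF.
- rewrite xE cutE; case: (boolP (i \in T)) => iT; case: (boolP (j \in T)) => jT /=.
  + by rewrite subrr mulr0 subr0 addr0 zD -(mE T) // zle // subD.
  + have := maxS T; rewrite TA iT jT => /(_ isT).
    by rewrite subr0 mulr1; clear; move: (xsum z T) (f T) s => a b c /=; lia.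
  (* Submodularity enters here: the merged constraints on the union and the intersection give z(S) +
     z(T) <= f(S) + f(T). *)
  + have h := xsumUI z S (T :\ j)%SET.
    have SA' : S \subset (A :\ j)%SET.
      apply/fintype.subsetP => k kS; rewrite !inE (fintype.subsetP SA) // andbT.
      by apply: contraNneq jS => <-.
    have u1 := zle (S :|: (T :\ j))%SET; rewrite finset.subUset SA' subD // in u1.
    have u2 := zle (S :&: (T :\ j))%SET; rewrite finset.subIset ?SA' // in u2.
    have {u1} := u1 isT; have {u2} := u2 isT; move: h.
    rewrite !ffunE !inE iS (negPf iT) /= !andbF.
    have -> : (j |: (S :|: T :\ j) = S :|: T)%SET.
      by rewrite finset.setUCA finset.setD1K.
    have -> : (S :&: (T :\ j) = S :&: T)%SET.
      apply/finset.setP => k; rewrite !inE; case: eqP => //= ->.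
      by rewrite (negPf jS).
    rewrite -(zD T) /s; have := fsub S T SA TA; clear.
    move: (f S) (f T) (f (S :|: T)%SET) (f (S :&: T)%SET) (xsum z S) (xsum z T).
    move: (xsum z (S :|: T :\ j)%SET) (xsum z (S :&: T)%SET) => a b c e g k l m; lia.
  + rewrite subrr mulr0 subr0 addr0; have := zle T; rewrite ffunE (negPf iT); apply.
    apply/fintype.subsetP => k kT; rewrite !inE (fintype.subsetP TA) // andbT.
    by apply: contraNneq jT => <-.
- by rewrite xE cutE iA jA subrr mulr0 subr0 addr0 zD zeq mE.
Qed.

End Submodular.

(** * Polynomiality of the point count *)

Section Polynomiality.
Variable n : nat.
Local Notation V := {ffun {set 'I_n} -> int}.
Implicit Types (A B S T U : {set 'I_n}) (f g h u : V).

Definition npts_poly A : Prop :=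
  exists2 p : V -> rat, polyf p & forall f, submod A f -> (npts A f)%:R = p f.

Definition pair_in A (p : 'I_n * 'I_n) : bool := [&& p.1 \in A, p.2 \in A & p.1 != p.2].

(** At S inside [A] the value is |S| |A \ S|, which is strictly submodular on incomparable pairs. *)
Definition cuts A : V := \sum_(p | pair_in A p) cut p.1 p.2.

Lemma submod_sum A I (r : seq I) (P : pred I) (F : I -> V) :
  (forall i, P i -> submod A (F i)) -> submod A (\sum_(i <- r | P i) F i).
Proof.
by move=> hF; apply: (big_ind (submod A)) => //; [exact: submod0 | exact: submodD].
Qed.

Lemma submod_cuts A B : submod A (cuts B).
Proof. by apply: submod_sum => p _; apply: submod_cut. Qed.

(** The slack comes from the single cut of a pair i in S \ T, j in T \ S; all other cuts are
    submodular. *)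
Lemma cuts_strict A S T : S \subset A -> T \subset A -> ~~ (S \subset T) -> ~~ (T \subset S) ->
  cuts A (S :|: T)%SET + cuts A (S :&: T)%SET + 1 <= cuts A S + cuts A T.
Proof.
move=> SA TA /fintype.subsetPn[i iS iT] /fintype.subsetPn[j jT jS].
have ij : i != j by apply: contraNneq iT => ->.
rewrite /cuts (bigD1 (i, j)) /=; last first.
  by rewrite /pair_in /= (fintype.subsetP SA) // (fintype.subsetP TA).
set r := \sum_(_ | _) _.
have [_ hr] : submod A r by apply: submod_sum => p _; apply: submod_cut.
have := hr S T SA TA; rewrite !ffunE !inE iS jT (negPf iT) (negPf jS) /=.
move: (r _) (r _) (r _) (r _) => a b c d; lia.
Qed.

(** Comparable sets give equality for any function; on incomparable ones the slack [M] absorbs four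
    values of [u], whence 4B. *)
Lemma submod_slack A u (M : int) (B : nat) : u finset.set0 = 0 ->
  (forall S, (`|u S| <= B)%N) -> (4 * B)%:Z <= M -> submod A (cuts A *~ M + u).
Proof.
move=> u0 hu hM; have [c0 hc] := submod_cuts A A.
split=> [|S T SA TA]; first by rewrite ffunE ffunMzE c0 mul0rz add0r.
have [/finset.setUidPr eU|nST] := boolP (S \subset T).
  have /finset.setIidPl eI : S \subset T by rewrite -eU finset.subsetUl.
  by rewrite eU eI addrC.
have [/finset.setUidPl eU|nTS] := boolP (T \subset S).
  have /finset.setIidPr eI : T \subset S by rewrite -eU finset.subsetUr.
  by rewrite eU eI.
have h1 := cuts_strict SA TA nST nTS.
have M0 : 0 <= M by apply: le_trans hM.
have h2 := ler_wpM2l M0 h1; rewrite !mulrDr mulr1 in h2.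
rewrite !ffunE !ffunMzE !mulrzz ![_ * M]mulrC.
move: (hu S) (hu T) (hu (S :|: T)%SET) (hu (S :&: T)%SET) h2 hM; clear.
move: (M * cuts A S) (M * cuts A T) (M * cuts A (S :|: T)%SET) (M * cuts A (S :&: T)%SET).
move: (u S) (u T) (u (S :|: T)%SET) (u (S :&: T)%SET) => *; lia.
Qed.

Lemma polyf_morph (U W : zmodType) (F : W -> rat) (h : U -> W) :
  {morph h : x y / x + y} -> polyf F -> polyf (fun x => F (h x)).
Proof.
move=> hD /(polyf_comp 0 hD); apply: polyf_ext => x.
by rewrite addr0.
Qed.

Lemma contrD S : {morph contr S : f g / f + g}.
Proof. by move=> f g; apply/ffunP => T; rewrite !ffunE opprD addrACA. Qed.

Lemma mergeD i j : {morph @merge n i j : f g / f + g}.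
Proof. by move=> f g; apply/ffunP => T; rewrite !ffunE. Qed.

Definition restr (s : seq {set 'I_n}) f : V := [ffun X => if X \in s then f X else 0].

Lemma restrD s : {morph restr s : f g / f + g}.
Proof. by move=> f g; apply/ffunP => T; rewrite !ffunE; case: ifP; rewrite ?addr0. Qed.

Section Step.
Variable A : {set 'I_n}.
Hypothesis IH : forall B, (#|B| < #|A|)%N -> npts_poly B.

(** Each cut adds a count on [A :\ j], polynomial by the induction hypothesis, and the function
    stays submodular throughout. *)
Lemma npts_add_cuts (r : seq ('I_n * 'I_n)) : exists2 q : V -> rat, polyf q &
  forall f, submod A f ->
    (npts A (f + \sum_(p <- r | pair_in A p) cut p.1 p.2))%:R = (npts A f)%:R + q f.
Proof.
elim: r => [|[i j] r [q hq qE]].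
  exists (fun _ => 0); first exact: polyf_cst.
  by move=> f _; rewrite big_nil !addr0.
have [hij|hij] := boolP (pair_in A (i, j)); last first.
  by exists q => // f hf; rewrite big_cons (negPf hij) qE.
have /and3P[/= iA jA ij] := hij.
have [|p hp pE] := @IH (A :\ j)%SET; first by rewrite [in ltnRHS](cardsD1 j) jA.
exists (fun f => p (merge i j f) + q (f + cut i j)).
  apply: polyfD; first by apply: polyf_morph hp; apply: mergeD.
  exact: (@polyf_comp _ _ q id).
move=> f hf; rewrite big_cons hij addrA qE; last exact/submodD/submod_cut.
by rewrite npts_cut // natrD pE ?addrA //; apply: submod_merge.
Qed.

Lemma npts_add_Mcuts : exists2 q : V -> rat, polyf q &
  forall f (M : int), submod A f -> 0 <= M ->
    (npts A (f + cuts A *~ M))%:R = (npts A f)%:R + sumz (fun m => q (f + cuts A *~ m)) M.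
Proof.
have [q hq qE] := npts_add_cuts (index_enum _).
exists q => // f M hf M0.
rewrite (@sumz_unique (fun m => q (f + cuts A *~ m)) (fun m => (npts A (f + cuts A *~ m))%:R)).
  by rewrite mulr0z addr0.
move=> j /orP[/andP[j0 _]|hj]; last by lia.
rewrite mulrzDr addrA mulr1z qE //.
by case: j j0 => // k _; rewrite -pmulrn; apply: submodD => //; apply/submodMn/submod_cuts.
Qed.

(* Starting from the large multiple [M] of [cuts A], change the values on the
   sets of [s] one unit at a time; every intermediate function is submodular. *)
Lemma npts_path (s : seq {set 'I_n}) : uniq s ->
  (forall S, S \in s -> [/\ S \subset A, S != A & S != finset.set0]) ->
  exists2 r : int * V -> rat, polyf r &
    forall (M : int) f (B : nat), (forall S, (`|f S| <= B)%N) -> (4 * B)%:Z <= M ->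
      (npts A (cuts A *~ M + restr s f))%:R = r (M, f).
Proof.
elim: s => [_ _|S s IHs /= /andP[Ss us] hs].
  have [q hq qE] := npts_add_Mcuts.
  (* The 1 counts the only point for the zero function, from which cut moves lead to
     [cuts A *~ M]. *)
  exists (fun x => 1 + sumz (fun m => q (cuts A *~ m)) x.1).
    apply: polyfD; first exact: polyf_cst.
    pose F (y : int * V) := q (cuts A *~ y.1).
    apply: (@polyf_sumz V F); apply: (@polyf_morph _ _ q (fun y : int * V => cuts A *~ y.1)) => //.
    by move=> x y; rewrite mulrzDr.
  move=> M f B _ hM; rewrite (_ : restr [::] f = 0); last by apply/ffunP => S; rewrite !ffunE.
  rewrite addrC qE ?npts0; [|exact: submod0|by lia].
  by congr (_ + _); apply: eq_sumz => m; rewrite add0r.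
have {IHs}[|r hr rE] := IHs us; first by move=> T Ts; apply: hs; rewrite inE Ts orbT.
have [SA SneA S0] := hs S (mem_head _ _).
have [|p hp pE] := @IH S; first by rewrite fintype.proper_card // finset.properEneq SneA.
have [|p' hp' pE'] := @IH (A :\: S)%SET.
  apply: fintype.proper_card; rewrite finset.properEneq finset.subsetDl andbT.
  apply: contra S0 => /eqP e; apply/eqP; rewrite -(finset.setIidPr SA) -[in LHS]e.
  by rewrite finset.setIC finset.setIDA finset.setIC finset.setDIl finset.setDv finset.setI0.
pose k (y : int * (int * V)) : V := cuts A *~ y.2.1 + restr s y.2.2 + single S *~ y.1.
have kD : {morph k : x y / x + y}.
  by move=> x y; rewrite /k /= restrD !mulrzDr [RHS]addrACA [X in _ = X + _]addrACA.
pose F y := p (k y + single S) * p' (contr S (k y + single S)).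
have hF : polyf F.
  apply: polyfM; first exact: polyf_comp hp.
  exact: (polyf_comp (F := fun h => p' (contr S h)) (single S) kD (polyf_morph (@contrD S) hp')).
exists (fun x => r x + sumz (fun j => F (j, x)) (x.2 S)).
  apply: polyfD => //.
  apply: (polyf_morph (h := fun x : int * V => (x.2 S, x)) _ (polyf_sumz hF)).
  by move=> x y; congr pair; rewrite /= ffunE.
move=> M f B hf hM; rewrite -(rE M f B) //.
have -> : restr (S :: s) f = restr s f + single S *~ f S.
  apply/ffunP => T; rewrite !ffunE ffunMzE ffunE inE.
  have [->|TS] /= := eqVneq T S; first by rewrite (negPf Ss) add0r mulrzz mul1r.
  by rewrite mul0rz addr0.
pose w j : rat := (npts A (cuts A *~ M + restr s f + single S *~ j))%:R.
rewrite addrA -[LHS]/(w (f S)) (@sumz_unique (fun j => F (j, (M, f))) w).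
  by rewrite /w mulr0z addr0.
move=> j hj; rewrite /w /F mulrzDr mulr1z addrA.
set h := _ + single S *~ j.
have hk : submod A (h + single S).
  have -> : h + single S = cuts A *~ M + (restr s f + single S *~ (j + 1)).
    by rewrite mulrzDr mulr1z !addrA.
  (* As j runs between 0 and [f S], the new value j + 1 stays within [B]. *)
  apply: (@submod_slack _ _ _ B) hM.
    rewrite !ffunE ffunMzE ffunE eq_sym (negPf S0) mul0rz addr0.
    case: ifP => // s0; have [|_ _] := hs finset.set0; first by rewrite finset.inE s0 orbT.
    by rewrite eqxx.
  move=> T; rewrite !ffunE ffunMzE ffunE.
  have [->|TS] := eqVneq T S.
    rewrite (negPf Ss) add0r mulrzz mul1r; move: (hf S) hj; move: (f S) => a; lia.
  by rewrite mul0rz addr0; case: ifP.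
rewrite npts_face // natrD natrM pE ?pE' //; first exact: submod_contr.
exact: submod_sub hk.
Qed.

(** For large M the count at f + M [cuts A] is [r (M, f)] by the path and N(f) plus a sum of [q] by
    cut moves. The difference of the two is polynomial in M, hence zero at M = 0, where it reads
    N(f) = [r (0, f)]. *)
Lemma npts_poly_step i : i \in A -> npts_poly A.
Proof.
move=> iA.
pose s := enum [pred S : {set 'I_n} | [&& S \subset A, S != A & S != finset.set0]].
have [||r hr rE] := @npts_path s; first exact: enum_uniq.
  by move=> S; rewrite mem_enum => /and3P.
have [q hq qE] := npts_add_Mcuts.
(* The path alters only nonempty proper subsets of [A], so it can reach only functions vanishing at
   [A]; a translation arranges this. *)
pose norm f : V := f - hits [set i]%SET *~ f A.
have normD : {morph norm : f g / f + g}.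
  by move=> f g; rewrite /norm !ffunE mulrzDr opprD addrACA.
exists (fun f => r (0, norm f)).
  apply: (polyf_morph (h := fun f => (0, norm f)) _ hr) => f g.
  by rewrite normD; congr pair; rewrite addr0.
move=> f0 hf0; have -> : npts A f0 = npts A (norm f0).
  by rewrite /norm -mulrNz npts_translate.
have nf : submod A (norm f0).
  have [f00 hf] := hf0.
  have mE S : norm f0 S = f0 S - (i \in S)%:R * f0 A.
    rewrite ffunE; congr (_ + _); rewrite !ffunE ffunMzE ffunE finset.setI_eq0.
    by rewrite disjoint_sym finset.disjoints1 negbK mulrzz natz.
  split=> [|S T SA TA]; first by rewrite mE f00 inE mul0r subr0.
  have := hf S T SA TA; rewrite !mE !inE; case: (i \in S); case: (i \in T) => /=;
  move: (f0 _) (f0 _) (f0 _) (f0 _) (f0 _) => *; lia.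
have nA : norm f0 A = 0.
  rewrite ffunE !ffunE ffunMzE ffunE finset.setI_eq0 disjoint_sym finset.disjoints1 iA.
  by rewrite mulrzz mul1r subrr.
move: (norm f0) nf nA => f hf fA {f0 hf0}; have [f0 _] := hf.
pose B := (\sum_(S : {set 'I_n}) `|f S|)%N.
have leB S : (`|f S| <= B)%N by rewrite /B (bigD1 S) //= leq_addr.
pose D (M : int) : rat :=
  r (M, f) - sumz (fun m => q (f + cuts A *~ m)) M - (npts A f)%:R.
have D0 : D 0 = 0.
  apply: (@polyf_eq0 D (4 * B)%:Z) => [|M hM].
    apply: polyfB; [apply: polyfB|exact: polyf_cst].
      apply: polyf_ext (polyf_comp (h := fun M : int => (M, 0 : V)) (0, f) _ hr) => [M|x y].
        by congr r; congr pair; rewrite /= ?addr0 ?add0r.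
      by congr pair; rewrite addr0.
    pose F (y : int * V) := q (cuts A *~ y.1 + f).
    have hF : polyf F.
      apply: (polyf_comp (h := fun y : int * V => cuts A *~ y.1)) hq.
      by move=> x y; rewrite mulrzDr.
    apply: polyf_ext (polyf_morph (h := fun M : int => (M, 0 : V)) _ (polyf_sumz hF)) => [M|x y].
      by apply: eq_sumz => m; rewrite /F /= addrC.
    by congr pair; rewrite addr0.
  rewrite /D -(rE M f B) // -addrA -opprD [X in _ - X]addrC -qE //; last by lia.
  apply/eqP; rewrite subr_eq0 [f + _]addrC; apply/eqP; congr _%:R; apply: eq_npts => S SA.
  rewrite !ffunE mem_enum inE SA; congr (_ + _).
  by have [->|_] := eqVneq S A => //=; have [->|_] := eqVneq S finset.set0.
by apply/esym/eqP; move/eqP: D0; rewrite /D sumz0 subr0 subr_eq0.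
Qed.

End Step.

Lemma npts_polyf A : npts_poly A.
Proof.
move: {2}(#|A|) (erefl #|A|) => k; elim/ltn_ind: k A => k IHk A cA.
have [A0|/finset.set0Pn[i iA]] := eqVneq A finset.set0.
  exists (fun _ => 1); first exact: polyf_cst.
  move=> f [f0 _]; rewrite -[RHS]/(1%N%:R) -(npts0 A); congr _%:R; apply: eq_npts => S.
  by rewrite A0 finset.subset0 => /eqP ->; rewrite f0 ffunE.
apply: (npts_poly_step _ iA) => B; rewrite cA => lt; exact: IHk lt _ erefl.
Qed.

End Polynomiality.

(** * Dilated simplices *)

(** The polynomial C(X + b, b), factored so that its linear coefficient H_b can be read off. *)
Definition simplex_poly (b : nat) : {poly rat} := \prod_(j < b) ((j.+1)%:R^-1 *: 'X + 1).

Lemma horner_simplex_poly b k : (simplex_poly b).[k%:R] = 'C(k + b, b)%:R.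
Proof.
elim: b => [|b IHb]; first by rewrite /simplex_poly big_ord0 hornerE bin0.
rewrite /simplex_poly big_ord_recr /= hornerM -/(simplex_poly b) IHb !hornerE.
have b1 : b.+1%:R != 0 :> rat by rewrite pnatr_eq0.
apply: (mulfI b1); rewrite -[RHS]natrM addnS -mul_bin_diag /= natrM -addnS natrD.
by move: ('C(_, _)%:R) (b.+1%:R) b1 => a c c0; field.
Qed.

Lemma coef_simplex_poly b :
  (simplex_poly b)`_0 = 1 /\ (simplex_poly b)`_1 = harmonic_number b.
Proof.
elim: b => [|b [IH0 IH1]]; first by rewrite /simplex_poly big_ord0 !coef1 harmonic0.
rewrite /simplex_poly big_ord_recr /= -/(simplex_poly b) !coefM !big_ord_recl !big_ord0 /=.
by rewrite !coefE /= IH0 IH1 harmonicS; split; ring.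
Qed.

Section Simplex.
Variable n : nat.
Implicit Types (A B S T : {set 'I_n}) (x : 'rV[int]_n).

Definition simplex A (k : nat) : set 'rV[int]_n :=
  [set x : 'rV[int]_n | [/\ forall i, 0 <= x 0 i, forall i, i \notin A -> x 0 i = 0
             & xsum x finset.setT = k%:Z]].

Lemma hitsE A S (k : nat) : (hits A *+ k) S = if (S :&: A == finset.set0)%SET then 0 else k%:Z.
Proof. by rewrite ffunMnE ffunE; case: eqP => _; rewrite ?mul0rn //= natz. Qed.

Lemma xsum_ge0 x S : (forall i, 0 <= x 0 i) -> 0 <= xsum x S.
Proof. by move=> x0; apply: sumr_ge0. Qed.

(** Comparing x(E \ i) <= k with x(E) = k gives x_i >= 0; outside [A] the bound x_i <= 0 does the
    rest. *)
Lemma pts_hits A k : A != finset.set0 -> pts finset.setT (hits A *+ k) = simplex A k.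
Proof.
move=> A0; apply/seteqP; split=> x.
  case/ptsP=> _ xle xeq; have xT : xsum x finset.setT = k.
    by rewrite xeq hitsE finset.setTI (negPf A0).
  have leT S : xsum x S <= k.
    by apply: le_trans (xle S (finset.subsetT _)) _; rewrite hitsE; case: ifP.
  have x0 i : 0 <= x 0 i.
    have := xsumD1 x (finset.in_setT i); rewrite xT.
    have := leT (finset.setT :\ i)%SET; move: (x 0 i) (xsum x _) => a b; lia.
  split=> // i iA; apply/eqP; rewrite eq_le x0 andbT.
  have := xle [set i]%SET (finset.subsetT _); rewrite xsum1 hitsE ifT //.
  by rewrite finset.setI_eq0 finset.disjoints1.
case=> x0 xA xT; apply/ptsP; split=> [i|S _|]; first by rewrite finset.in_setT.
  have [e|ne] := boolP (S :&: A == finset.set0)%SET.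
    rewrite hitsE e xsum_eq0 // => i iS; apply: xA; apply/negP => iA.
    by move/eqP/finset.setP/(_ i): e; rewrite !inE iS iA.
  rewrite hitsE (negPf ne).
  rewrite -xT (xsumID x finset.setT S) finset.setTI lerDl; exact: xsum_ge0.
by rewrite hitsE finset.setTI (negPf A0).
Qed.

Lemma finite_simplex A k : A != finset.set0 -> finite_set (simplex A k).
Proof. by move=> A0; rewrite -pts_hits //; apply: finite_pts. Qed.

(** Pascal's rule: points with x_i = 0 live on [A :\ i], the others become points of the dilate k
    after subtracting e_i. *)
Lemma cnt_simplex A b k : #|A| = b.+1 -> cnt (simplex A k) = 'C(k + b, b).
Proof.
elim: b A k => [|b IHb] A k cA.
  have /cards1P[i eA] : #|A| == 1%N by rewrite cA.
  rewrite bin0 (_ : simplex A k = [set k%:Z *: delta_mx 0 i]) ?cnt1 //.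
  apply/seteqP; split=> x /=.
    move=> [x0 xA xT]; apply/rowP => j; rewrite !mxE eqxx.
    have [->|ji] := eqVneq j i; last by rewrite xA ?mulr0 // eA inE.
    rewrite mulr1 -xT (xsumID x finset.setT A) finset.setTI eA xsum1 xsum_eq0 ?addr0 //.
    by move=> l; rewrite !inE andbT => li; apply: xA; rewrite eA inE.
  move=> ->; split=> [j|j|].
  - by rewrite !mxE mulr_ge0 //; case: (_ && _).
  - by rewrite eA inE !mxE => /negPf ->; rewrite andbF mulr0.
  - by rewrite xsumZ xsum_delta inE mulr1.
have /card_gt0P[i iA] : (0 < #|A|)%N by rewrite cA.
pose B := (A :\ i)%SET.
have cB : #|B| = b.+1 by have := finset.cardsD1 i A; rewrite iA cA => -[].
have A0 : A != finset.set0 by rewrite -finset.card_gt0 cA.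
have B0 : B != finset.set0 by rewrite -finset.card_gt0 cB.
elim: k => [|k IHk].
  rewrite add0n binn (_ : simplex A 0 = [set 0]) ?cnt1 //.
  apply/seteqP; split=> x /=.
    move=> [x0 _ xT]; apply/rowP => j; rewrite mxE.
    have /psumr_eq0P := xT; apply => //.
  by move=> ->; split=> [j|j _|]; rewrite ?xsum_eq0 ?mxE // => j _; rewrite mxE.
have -> : simplex A k.+1 = simplex B k.+1 `|` (fun x => x + delta_mx 0 i) @` simplex A k.
  apply/seteqP; split=> x.
    move=> [x0 xA xT]; have [xi|xi] := eqVneq (x 0 i) 0; [left|right].
      by split=> // j; rewrite !inE negb_and negbK => /orP[/eqP ->|/xA].
    exists (x - delta_mx 0 i); last by rewrite subrK.
    split=> [j|j jA|]; last first.
    - by rewrite xsumB xsum_delta xT inE -natz -addn1 natrD addrK natz.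
    - rewrite !mxE xA // eqxx; case: (eqVneq j i) => [ji|_]; last by rewrite subr0.
      by rewrite ji iA in jA.
    - rewrite !mxE eqxx /=; case: eqP => [->|]; last by rewrite subr0.
      by move: (x0 i) xi; move: (x 0 i) => a; lia.
  case=> [[x0 xB xT]|[y [y0 yA yT] <-]].
    by split=> // j jA; apply: xB; rewrite !inE (negPf jA) andbF.
  split=> [j|j jA|].
  - by rewrite !mxE addr_ge0 //; case: (_ && _).
  - rewrite !mxE yA // eqxx; case: (eqVneq j i) => [ji|_] //.
    by rewrite ji iA in jA.
  - by rewrite xsumD xsum_delta yT inE -natz natr1 natz.
rewrite cntU; [|exact: finite_simplex|exact/finite_image/finite_simplex|].
  rewrite cnt_image; [|exact: finite_simplex|by move=> x y _ _ /addIr].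
  by rewrite IHk IHb // addnS binS addSn addnC addnS.
move=> x [_ xB _] [y [y0 _ _] yx]; have := xB i; rewrite !inE eqxx => /(_ isT).
by rewrite -yx !mxE !eqxx /=; move: (y0 i); move: (y 0 i) => a; lia.
Qed.

Theorem npts_linear_coef : exists (d : nat) (p : {ffun {set 'I_n} -> int} -> rat),
  [/\ pdeg d p, forall f, submod finset.setT f -> (npts finset.setT f)%:R = p f &
      forall f : {ffun {set 'I_n} -> int}, f finset.set0 = 0 -> linear_coef d p f = rank_form f].
Proof.
have [p [d pd] pE] := npts_polyf (finset.setT : {set 'I_n}).
exists d, p; split=> // f f0; apply/eqP; rewrite -subr_eq0; apply/eqP.
apply: (@hits_span n (fun f => linear_coef d p f - rank_form f)) f0 => [g h|A A0].
  by rewrite (linear_coefD _ _ pd) rank_formD opprD addrACA.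
rewrite rank_form_hits // /linear_coef.
have cA : #|A| = (#|A|.-1).+1 by rewrite prednK // finset.card_gt0.
have -> : newton_poly d (hits A) p = simplex_poly #|A|.-1.
  apply: poly_nat_inj => k; rewrite newton_polyE // horner_simplex_poly -(cnt_simplex k cA).
  rewrite -pts_hits // -pE //; apply: submodMn; split=> [|S T _ _].
    by rewrite ffunE finset.set0I eqxx.
  rewrite !ffunE finset.setIUl finset.setU_eq0 negb_and.
  have : (S :&: A == finset.set0)%SET -> (S :&: T :&: A == finset.set0)%SET.
    by move=> /eqP e; rewrite finset.setIAC e finset.set0I.
  have : (T :&: A == finset.set0)%SET -> (S :&: T :&: A == finset.set0)%SET.
    by move=> /eqP e; rewrite -finset.setIA e finset.setI0.
  case: (S :&: A == _)%SET; case: (T :&: A == _)%SET; case: (S :&: T :&: A == _)%SET => //= h1 h2;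
    by [have := h1 isT | have := h2 isT].
by rewrite (coef_simplex_poly _).2 subrr.
Qed.

End Simplex.

(** * Integrality of base polytopes *)

Section ConvexHull.
Variables (R : realType) (V : lmodType R).
Implicit Types (X Y Z K : set V) (x y : V).

Lemma convex_setP K : @convex_set R V K <->
  forall x y (t : R), 0 <= t <= 1 -> K x -> K y -> K (t *: x + (1 - t) *: y).
Proof.
split=> [cK x y t /andP[t0 t1] Kx Ky|cK x y t].
  have := cK x y (Itv01 t0 t1); rewrite !inE; exact.
by rewrite !inE => Kx Ky; apply: cK => //; rewrite ge0 le1.
Qed.

Lemma conv_hull_sub X : X `<=` conv_hull X.
Proof. exact: sub_gen_smallest. Qed.

Lemma conv_hull_convex X : @convex_set R V (conv_hull X).
Proof.
apply/convex_setP => x y t t01 hx hy K /= KP.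
have /convex_setP := KP.1; apply => //; [exact: hx|exact: hy].
Qed.

Lemma conv_hull_min X K : @convex_set R V K -> X `<=` K -> conv_hull X `<=` K.
Proof. exact: smallest_sub. Qed.

(** Minimality of the hull is used twice: for fixed x in [X] the admissible y form a convex set
    containing [Y]; then the x admissible for the whole hull of [Y] form a convex set containing
    [X]. *)
Lemma conv_hull_add X Y Z : (forall x y, X x -> Y y -> Z (x + y)) ->
  forall x y, conv_hull X x -> conv_hull Y y -> conv_hull Z (x + y).
Proof.
move=> XYZ x y hx; move: x hx y.
have /convex_setP cZ := @conv_hull_convex Z.
have shift (a b c : V) (t : R) : t *: a + (1 - t) *: b + c = t *: (a + c) + (1 - t) *: (b + c).
  rewrite !scalerDr addrACA -scalerDl (_ : t + (1 - t) = 1) ?scale1r //; ring.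
have step x : X x -> conv_hull Y `<=` [set y | conv_hull Z (x + y)].
  move=> Xx; apply: conv_hull_min => [|y Yy /=]; last by apply: conv_hull_sub; exact: XYZ.
  apply/convex_setP => a b t t01 /= ha hb.
  by rewrite addrC shift; apply: cZ => //; rewrite addrC.
suff : conv_hull X `<=` [set x | forall y, conv_hull Y y -> conv_hull Z (x + y)].
  by move=> h x /h.
apply: conv_hull_min => [|x Xx y]; last exact: step.
apply/convex_setP => a b t t01 /= ha hb y hy.
by rewrite shift; apply: cZ => //; [exact: ha|exact: hb].
Qed.

End ConvexHull.

Section Integrality.
Variables (R : realType) (n : nat).
Implicit Types (A S T : {set 'I_n}) (f : {ffun {set 'I_n} -> int}) (u : 'rV[R]_n) (z : 'rV[int]_n).

Definition toR z : 'rV[R]_n := map_mx intr z.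

Lemma toRD y z : toR (y + z) = toR y + toR z.
Proof. by apply/rowP => i; rewrite !mxE intrD. Qed.

Lemma xsum_toR z S : xsum (toR z) S = (xsum z S)%:~R.
Proof.
rewrite /xsum (big_morph _ (@intrD R) (mulr0z _)).
by apply: eq_bigr => i _; rewrite mxE.
Qed.

Lemma base_polytope_toR A f z : base_polytope A f (toR z) <-> pts A f z.
Proof.
split=> [[z0 zle zeq]|/ptsP[z0 zle zeq]]; [apply/ptsP|]; split.
- by move=> i /z0; rewrite mxE => /eqP; rewrite intr_eq0 => /eqP.
- by move=> S /zle; rewrite xsum_toR ler_int.
- by move/eqP: zeq; rewrite xsum_toR eqr_int => /eqP.
- by move=> i /z0; rewrite mxE => ->.
- by move=> S /zle; rewrite xsum_toR ler_int.
- by rewrite xsum_toR zeq.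
Qed.

Lemma base_polytope_convex A f : @convex_set R _ (@base_polytope n R A f).
Proof.
apply/convex_setP => x y t /andP[t0 t1] [x0 xle xeq] [y0 yle yeq].
have t1' : 0 <= 1 - t by rewrite subr_ge0.
split=> [i iA|S SA|].
- by rewrite !mxE x0 ?y0 // !mulr0 addr0.
- rewrite xsumD !xsumZ.
  apply: le_trans (lerD (ler_wpM2l t0 (xle S SA)) (ler_wpM2l t1' (yle S SA))) _.
  by rewrite -mulrDl (_ : t + (1 - t) = 1) ?mul1r //; ring.
- by rewrite xsumD !xsumZ xeq yeq -mulrDl (_ : t + (1 - t) = 1) ?mul1r //; ring.
Qed.

(** Along e_i - e_j only constraints with i inside and j outside tighten; [t] is their least slack,
    and the minimizing set becomes tight. *)
Lemma move_to_face A f u i j : i \in A -> j \in A -> i != j -> base_polytope A f u ->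
  exists (t : R) S, [/\ 0 <= t, S \subset A, i \in S /\ j \notin S,
    base_polytope A f (u + t *: (delta_mx 0 i - delta_mx 0 j)) &
    xsum (u + t *: (delta_mx 0 i - delta_mx 0 j)) S = (f S)%:~R].
Proof.
move=> iA jA ij [u0 ule ueq].
have h1 : ([set i]%SET \subset A) && (i \in [set i]%SET) && (j \notin [set i]%SET).
  by rewrite finset.sub1set iA !inE eqxx eq_sym ij.
have [S /andP[/andP[SA iS] jS] minS] := @Order.TotalTheory.arg_minP _ _ _ [set i]%SET
  (fun S : {set 'I_n} => (S \subset A) && (i \in S) && (j \notin S))
  (fun S => (f S)%:~R - xsum u S) h1.
set t := _ - _ in minS; have t0 : 0 <= t by rewrite subr_ge0 ule.
have E T : xsum (u + t *: (delta_mx 0 i - delta_mx 0 j)) T =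
    xsum u T + t * ((i \in T)%:R - (j \in T)%:R).
  by rewrite xsumD xsumZ xsumB !xsum_delta.
exists t, S; split=> //; last first.
  by rewrite E iS (negPf jS) subr0 mulr1 /t addrC subrK.
split=> [k kA|T TA|].
- have ki : (k == i) = false by apply: contraNF kA => /eqP ->.
  have kj : (k == j) = false by apply: contraNF kA => /eqP ->.
  by rewrite !mxE u0 // ki kj andbF subrr mulr0 addr0.
- rewrite E; case: (boolP (i \in T)) => iT; case: (boolP (j \in T)) => jT /=.
  + by rewrite subrr mulr0 addr0 ule.
  + have := minS T; rewrite TA iT jT => /(_ isT).
    by rewrite subr0 mulr1 lerBrDl.
  + by rewrite sub0r mulrN1; apply: le_trans (ule T TA); rewrite gerBl.
  + by rewrite subrr mulr0 addr0 ule.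
- by rewrite E iA jA subrr mulr0 addr0.
Qed.

(** Moving in the two directions e_i - e_j and e_j - e_i until a face is met puts [u] on a segment
    between two faces; each face is a sum of smaller base polytopes, integral by induction on
    |A|. *)
Theorem base_polytope_integral A f : submod A f ->
  @base_polytope n R A f `<=` conv_hull (toR @` pts A f).
Proof.
move: {2}(#|A|) (erefl #|A|) => k; elim/ltn_ind: k A f => k IHk A f cA hf u hu.
have [f0 _] := hf.
have point z : toR z = u -> conv_hull (toR @` pts A f) u.
  by move=> e; apply: conv_hull_sub; exists z => //; apply/base_polytope_toR; rewrite e.
have [A0|/finset.set0Pn[i iA]] := eqVneq A finset.set0.
  have [u0 _ _] := hu; apply: (point 0); apply/rowP => i.
  by rewrite !mxE u0 // A0 inE.
have [A1|/finset.set0Pn[j]] := eqVneq (A :\ i)%SET finset.set0.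
  have [u0 _ ueq] := hu; apply: (point (f A *: delta_mx 0 i)); apply/rowP => j.
  have eA : A = [set i]%SET by rewrite -(finset.setD1K iA) A1 finset.setU0.
  rewrite !mxE eqxx /=; have [->|ji] := eqVneq j i; first by rewrite mulr1 -ueq eA xsum1.
  by rewrite mulr0 u0 // eA inE.
rewrite !inE => /andP[ji jA].
have face v S : S \subset A -> S != A -> S != finset.set0 -> base_polytope A f v ->
    xsum v S = (f S)%:~R -> conv_hull (toR @` pts A f) v.
  move=> SA SneA S0 hv vS; have [v1 [v2 [h1 h2 ->]]] := face_split SA hv vS.
  have l1 : (#|S| < k)%N.
    by rewrite -cA fintype.proper_card // finset.properEneq SneA.
  have l2 : (#|(A :\: S)%SET| < k)%N.
    have := finset.cardsID S A; rewrite (finset.setIidPr SA) cA => <-.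
    by rewrite -[ltnLHS]add0n ltn_add2r finset.card_gt0.
  apply: conv_hull_add (IHk _ l1 S f erefl (submod_sub SA hf) _ h1)
    (IHk _ l2 _ _ erefl (submod_contr SA hf) _ h2).
  move=> _ _ [y hy <-] [z hz <-]; exists (y + z); last by rewrite toRD.
  by have [] := face_join SA hf hy hz.
have face' v S a b : a \in A -> b \in A -> S \subset A -> a \in S -> b \notin S -> base_polytope A f v ->
    xsum v S = (f S)%:~R -> conv_hull (toR @` pts A f) v.
  move=> aA bA SA aS bS; apply: face => //; first by apply: contraNneq bS => ->.
  by apply/finset.set0Pn; exists a.
have ij : i != j by rewrite eq_sym.
have [t [S [t0 SA [iS jS] hp ep]]] := move_to_face iA jA ij hu.
have [t' [S' [t0' SA' [jS' iS'] hm em]]] := move_to_face jA iA ji hu.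
have Hp := face' _ _ _ _ iA jA SA iS jS hp ep.
have Hm := face' _ _ _ _ jA iA SA' jS' iS' hm em.
(* If neither move has positive length, [u] itself lies on a face. *)
have [e|s0] := eqVneq (t + t') 0.
  have et : t = 0 by move: t0 t0' e; lra.
  by move: Hp; rewrite et scale0r addr0.
have sp : 0 < t + t' by rewrite lt_neqAle eq_sym s0 addr_ge0.
set d : 'rV[R]_n := delta_mx 0 i - delta_mx 0 j in Hp *.
have ed : delta_mx 0 j - delta_mx 0 i = - d by rewrite opprB.
rewrite ed in Hm.
have /convex_setP := @conv_hull_convex _ _ (toR @` pts A f).
move=> /(_ _ _ (t' / (t + t')) _ Hp Hm).
have -> : t' / (t + t') *: (u + t *: d) + (1 - t' / (t + t')) *: (u + t' *: - d) = u.
  by apply/rowP => l; rewrite !mxE; field.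
by apply; rewrite divr_ge0 ?(ltW sp) //= ler_pdivrMr // mul1r lerDr.
Qed.

End Integrality.

(** * Matroid polytopes *)

Section MatroidPolytope.
Variables (R : realType) (n : nat) (M : matroid 'I_n).
Implicit Types (B S T : {set 'I_n}) (z : 'rV[int]_n).

Lemma submod_rkf : submod finset.setT (rkf M).
Proof.
split=> [|S T _ _]; first by rewrite ffunE rk0.
by rewrite !ffunE -!PoszD lez_nat rk_submod.
Qed.

Definition int_indic B : 'rV[int]_n := \sum_(i in B) delta_mx 0 i.

Lemma toR_indic B : toR R (int_indic B) = indic R B.
Proof.
apply/rowP => j; rewrite mxE !summxE (big_morph _ (@intrD R) (mulr0z _)).
by apply: eq_bigr => i _; rewrite !mxE; case: (_ && _).
Qed.

Lemma int_indicE B i : int_indic B 0 i = (i \in B)%:R.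
Proof.
have := xsum_delta int i B; rewrite /xsum summxE => <-.
by apply: eq_bigr => j _; rewrite !mxE eq_sym.
Qed.

Lemma xsum_indic B S : xsum (int_indic B) S = #|B :&: S|%:Z.
Proof.
rewrite /xsum (eq_bigr (fun i => (i \in B)%:R)) => [|i _]; last exact: int_indicE.
rewrite -sum1_card -natz natr_sum [LHS]big_mkcond [RHS]big_mkcond; apply: eq_bigr => i _.
by rewrite inE; case: (i \in B); case: (i \in S).
Qed.

(** Singletons and their complements force 0/1 coordinates. The support B has [rank M] elements and
    |B| <= [rk M B], so a basis attaining that rank contains B and equals it. *)
Lemma pts_rkf : pts finset.setT (rkf M) = int_indic @` [set` bases M].
Proof.
apply/seteqP; split=> [z /ptsP[_ zle zeq]|_ [B /= BM <-]].
  have {}zeq : xsum z finset.setT = (rank M)%:Z by rewrite zeq ffunE rkT.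
  have {}zle S : xsum z S <= (rk M S)%:Z by have := zle S (finset.subsetT _); rewrite ffunE.
  have z01 i : 0 <= z 0 i <= 1.
    have h1 := zle [set i]%SET; have h2 := rk_leq_card M [set i]%SET.
    rewrite finset.cards1 in h2; rewrite xsum1 in h1.
    have := xsumD1 z (finset.in_setT i); rewrite zeq.
    have := zle (finset.setT :\ i)%SET; have := rk_leq_rank M (finset.setT :\ i)%SET.
    move: h1 h2; clear; move: (z 0 i) (xsum z _) (rk M _) (rk M _) (rank M) => *; lia.
  pose B := [set i | z 0 i == 1]%SET.
  have eB : int_indic B = z.
    apply/rowP => i; rewrite int_indicE inE; have := z01 i.
    by case: eqP => [-> //|]; move: (z 0 i) => a; lia.
  have cB : #|B| = rank M by apply/eqP; rewrite -eqz_nat -zeq -eB xsum_indic finset.setIT.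
  exists B => //=; have [A AM eA] := rk_attained M B.
  suff <- : A = B by [].
  have := zle B; rewrite -eB xsum_indic finset.setIid lez_nat -eA => le.
  have BA : B \subset A.
    apply/finset.setIidPr/eqP; rewrite finset.eqEcard finset.subsetIr; exact: le.
  by apply/eqP; rewrite eq_sym finset.eqEcard BA cB (card_basis AM) leqnn.
apply/ptsP; split=> [i|S _|]; first by rewrite finset.in_setT.
  by rewrite xsum_indic ffunE lez_nat rk_ge.
by rewrite xsum_indic ffunE rkT finset.setIT (card_basis BM).
Qed.

Lemma matroid_polytopeE : @matroid_polytope R n M = base_polytope finset.setT (rkf M).
Proof.
rewrite /matroid_polytope.
have -> : [set indic R B | B in [set` bases M]] = @toR R n @` pts finset.setT (rkf M).
  rewrite pts_rkf; apply/seteqP; split=> [_ [B BM <-]|_ [_ [B BM <-] <-]].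
    by exists (int_indic B); [exists B | exact: toR_indic].
  by exists B; rewrite ?toR_indic.
apply/seteqP; split; last by apply: base_polytope_integral; exact: submod_rkf.
apply: conv_hull_min; first exact: base_polytope_convex.
by move=> _ [z hz <-]; apply/base_polytope_toR.
Qed.

Lemma intr_mulrn (a : int) k : (a *+ k)%:~R = k%:R * a%:~R :> R.
Proof. by rewrite -[a *+ k]mulr_natl intrM natz. Qed.

Lemma base_polytopeZ (f : {ffun {set 'I_n} -> int}) (k : nat) (x : 'rV[R]_n) :
  base_polytope finset.setT f x -> base_polytope finset.setT (f *+ k) (k%:R *: x).
Proof.
move=> [_ xle xeq]; split=> [i|S ST|]; first by rewrite finset.in_setT.
  by rewrite xsumZ ffunMnE intr_mulrn; apply: ler_wpM2l (xle S ST).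
by rewrite xsumZ ffunMnE intr_mulrn xeq.
Qed.

Lemma lattice_pointsE k : lattice_points R M k = pts finset.setT (rkf M *+ k).
Proof.
apply/seteqP; split=> [z [x]|z hz].
  rewrite matroid_polytopeE => /(base_polytopeZ k) hx ez.
  by apply/(base_polytope_toR R); rewrite /toR ez.
(* Division by k is impossible at k = 0; there any basis supplies the required point of the
   polytope. *)
case: k hz => [|k].
  rewrite mulr0n pts0 => ->; have [B BM] := ex_basis M; exists (indic R B).
    by apply: conv_hull_sub; exists B.
  by rewrite scale0r; apply/rowP => i; rewrite !mxE.
have k0 : 0 < k.+1%:R :> R by rewrite ltr0n.
move=> /(base_polytope_toR R)[_ zle zeq]; exists (k.+1%:R^-1 *: toR R z); last first.
  by rewrite scalerA divff ?scale1r // gt_eqF.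
rewrite matroid_polytopeE; split=> [i|S ST|]; first by rewrite finset.in_setT.
  by rewrite xsumZ ler_pdivrMl // -intr_mulrn -ffunMnE zle.
by rewrite xsumZ zeq ffunMnE intr_mulrn mulKf // gt_eqF.
Qed.

Lemma ehr_linear_coef : (ehr R M)^`().[0] = rank_form (rkf M).
Proof.
have [d [p [pd pE pL]]] := npts_linear_coef n.
have hP : is_ehrhart R M (newton_poly d (rkf M) p).
  move=> k; exists (npts finset.setT (rkf M *+ k)).
    by rewrite lattice_pointsE; apply/card_eq_cnt/finite_pts.
  by rewrite newton_polyE // -pE //; apply/submodMn/submod_rkf.
have -> : ehr R M = newton_poly d (rkf M) p.
  by apply: (@is_ehrhart_unique R _ M) => //; apply: (xgetPex 0); exists (newton_poly d (rkf M) p).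
by rewrite horner_coef0 coef_deriv mulr1n -pL // ffunE rk0.
Qed.

End MatroidPolytope.

(** * Isomorphism with the extremal matroids *)

Section Isomorphism.
Variables (n r : nat) (M : matroid 'I_n).

Lemma iso_uniform (hrn : (r <= n)%N) :
  matroid_iso M (uniform hrn) <-> bases M = [set B : {set 'I_n} | #|B| == r]%SET.
Proof.
split=> [[f bf fE]|eM].
  by apply/finset.setP => B; rewrite fE !inE finset.card_imset //; apply: bij_inj.
exists id => [|B]; first by exists id.
by rewrite finset.imset_id eM.
Qed.

Lemma dsum_uniform_bases l (C : {set 'I_r + 'I_l}) :
  (C \in bases (dsum (uniform (leqnn r)) (uniform (leq0n l)))) =
  (C == inl @: [set: 'I_r])%SET.
Proof.
have injl : injective (@inl 'I_r 'I_l) by move=> ? ? [].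
rewrite !inE finset.cards_eq0; apply/andP/eqP => [[/eqP cl /eqP er]|->].
  have {}cl : (inl @^-1: C = [set: 'I_r])%SET.
    by apply/eqP; rewrite finset.eqEcard finset.subsetT finset.cardsT card_ord cl leqnn.
  apply/finset.setP => -[i|j].
    rewrite (finset.mem_imset _ _ injl) finset.in_setT.
    by move/finset.setP/(_ i): cl; rewrite !inE.
  transitivity false; first by move/finset.setP/(_ j): er; rewrite !inE.
  by apply/esym/negbTE/negP => /finset.imsetP[].
split; last first.
  by apply/eqP/finset.setP => j; rewrite !inE; apply/negbTE/negP => /finset.imsetP[].
rewrite (_ : _ @^-1: _ = finset.setT)%SET ?finset.cardsT ?card_ord //.
by apply/finset.setP => i; rewrite !inE (finset.mem_imset _ _ injl) finset.in_setT.
Qed.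

(** The direct sum has a single basis, its left summand, so only the number of bases matters: [g]
    below enumerates [B] by the coloops and its complement by the loops. *)
Lemma iso_dsum_uniform l (B : {set 'I_n}) : B \in bases M -> #|B| = r -> l = (n - r)%N ->
  matroid_iso M (dsum (uniform (leqnn r)) (uniform (leq0n l))) <-> bases M = [set B]%SET.
Proof.
move=> BM cB el; split=> [[f bf fE]|eM].
  have h C : (C \in bases M) = (f @: C == inl @: [set: 'I_r])%SET by rewrite fE dsum_uniform_bases.
  apply/finset.setP => C; rewrite inE; apply/idP/eqP => [|-> //].
  move: BM; rewrite !h => /eqP eB /eqP eC.
  by apply: (finset.imset_inj (bij_inj bf)); rewrite eC.
have cC : #|(~: B)%SET| = l by rewrite finset.cardsCs finset.setCK card_ord cB el.
pose g (x : 'I_r + 'I_l) : 'I_n := match x with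
  | inl k => enum_val (cast_ord (esym cB) k)
  | inr k => enum_val (cast_ord (esym cC) k) end.
have gl k : g (inl k) \in B by exact: enum_valP.
have gr k : g (inr k) \notin B by have := enum_valP (cast_ord (esym cC) k); rewrite inE.
have ginj : injective g.
  move=> [k|k] [k'|k'] e.
  - by congr inl; move/enum_val_inj/cast_ord_inj: e.
  - by have := gr k'; rewrite -e gl.
  - by have := gr k; rewrite e gl.
  - by congr inr; move/enum_val_inj/cast_ord_inj: e.
have bg : bijective g.
  apply: inj_card_bij ginj _; rewrite card_sum !card_ord el.
  by have := max_card B; rewrite card_ord cB => /subnKC ->.
have [f gK fK] := bg.
have bf : bijective f by exists g.
exists f => // C; rewrite dsum_uniform_bases eM inE.
have <- : (f @: B = inl @: [set: 'I_r])%SET.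
  have -> : B = (g @: (inl @: [set: 'I_r]))%SET.
    apply/esym/eqP; rewrite finset.eqEcard; apply/andP; split.
      by apply/fintype.subsetP => _ /finset.imsetP[_ /finset.imsetP[k _ ->] ->].
    by rewrite !finset.card_imset ?finset.cardsT ?card_ord ?cB // => ? ? [].
  rewrite -finset.imset_comp (finset.eq_imset (g := id)) ?finset.imset_id //.
by rewrite (inj_eq (finset.imset_inj (bij_inj bf))).
Qed.

End Isomorphism.

Theorem corollary3 (R : realType) (n r l : nat) (hrn : (r <= n)%N)
    (hl : l = (n - r)%N) (M : matroid 'I_n) (hM : rank M = r) :
  let d := (ehr R M)^`().[0] in
  let bound := n%:R * harmonic_number n - r%:R * harmonic_number r
               - l%:R * harmonic_number l in
  [/\ 0 <= d <= bound,
      d = 0 <-> matroid_iso M (dsum (uniform (leqnn r)) (uniform (leq0n l))) &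
      d = bound <-> matroid_iso M (uniform hrn)].
Proof.
move=> d bound.
have -> : d = rank_form (rkf M) by exact: ehr_linear_coef.
have -> : bound = rank_form (uniform_rank n (rank M)).
  by rewrite /bound hl hM rank_form_uniform.
have [B BM] := ex_basis M.
split; first by rewrite rank_form_rk_ge0 rank_form_rk_le.
- rewrite (rank_form_rk_eq0 BM); apply: iff_sym; apply: iso_dsum_uniform => //.
  by rewrite (card_basis BM).
- by rewrite rank_form_rk_eq_uniform hM; apply: iff_sym; apply: iso_uniform.
Qed.
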